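(* Let $G$ be a $\sigma$-compact locally compact Abelian group and $\Lambda\subset G$ relatively dense and period-stable. The following are equivalent: (i) $\Lambda$ is a model set; (ii) $\Lambda$ has finite local complexity and there is a nonzero positive sup-almost periodic discrete measure $\eta$ with $\eta\le\delta_\Lambda$; (iii) $\Lambda$ has finite local complexity and there is a nonzero positive norm-almost periodic discrete measure $\eta$ with $\eta\le\delta_\Lambda$; (iv) $\Lambda-\Lambda$ is uniformly discrete and there is a nonzero positive strongly almost periodic discrete measure $\eta$ with $\eta\le\delta_\Lambda$.
   Context: $\Lambda$ is period-stable if for every subgroup $H'\le G$ with $H'\subset\Lambda-\Lambda$ one has $H'+\Lambda=\Lambda$. $\delta_\Lambda=\sum_{x\in\Lambda}\delta_x$. Finite local complexity: $\Lambda-\Lambda$ locally finite. Fix compact $K$ with nonempty interior; $\|\mu\|_K=\sup_t|\mu|(t+K)$, $T_t\mu(A)=\mu(A-t)$. Norm-almost periodic: $\{t:\|\eta-T_t\eta\|_K<\varepsilon\}$ relatively dense for all $\varepsilon>0$; sup-almost periodic: $\{t:\sup_x|\eta(\{t+x\})-\eta(\{x\})|<\varepsilon\}$ relatively dense for all $\varepsilon>0$; strongly almost periodic: $f*\eta$ is a Bohr almost periodic function for every $f\in C_c(G)$. A model set is $\{x\in\pi_1(\widetilde L):x^\star\in W\}$ for a cut and project scheme $(G\times H,\widetilde L)$ ($H$ locally compact Abelian, $\widetilde L$ discrete cocompact subgroup of $G\times H$, $\pi_1|_{\widetilde L}$ injective, $\pi_2(\widetilde L)$ dense, $x^\star=\pi_2((\pi_1|_{\widetilde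 L})^{-1}(x))$) and $W\subset H$ precompact with nonempty interior. *)

(* Defs.v *)
From Stdlib Require Import Reals List Classical.
Open Scope R_scope.

Definition is_compact {X : Type} (op : (X -> Prop) -> Prop) (K : X -> Prop) : Prop :=
  forall F : (X -> Prop) -> Prop,
    (forall U, F U -> op U) ->
    (forall x, K x -> exists U, F U /\ U x) ->
    exists l : list (X -> Prop),
      (forall U, In U l -> F U) /\ (forall x, K x -> exists U, In U l /\ U x).

Definition closure {X : Type} (op : (X -> Prop) -> Prop) (A : X -> Prop) (x : X) : Prop :=
  forall U, op U -> U x -> exists y, U y /\ A y.

Record LCAGroup : Type := mkLCA {
  car :> Type;
  gzero : car;
  gadd : car -> car -> car;
  gopp : car -> car;
  gaddA : forall x y z, gadd x (gadd y z) = gadd (gadd x y) z;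
  gaddC : forall x y, gadd x y = gadd y x;
  gadd0 : forall x, gadd gzero x = x;
  gaddN : forall x, gadd (gopp x) x = gzero;
  gopen : (car -> Prop) -> Prop;
  gopen_full : gopen (fun _ => True);
  gopen_inter : forall U V, gopen U -> gopen V -> gopen (fun x => U x /\ V x);
  gopen_union : forall F : (car -> Prop) -> Prop,
      (forall U, F U -> gopen U) -> gopen (fun x => exists U, F U /\ U x);
  gadd_cont : forall x y U, gopen U -> U (gadd x y) ->
      exists V W, gopen V /\ gopen W /\ V x /\ W y /\
                  forall a b, V a -> W b -> U (gadd a b);
  gopp_cont : forall x U, gopen U -> U (gopp x) ->
      exists V, gopen V /\ V x /\ forall a, V a -> U (gopp a);
  ghausdorff : forall x y, x <> y ->
      exists U V, gopen U /\ gopen V /\ U x /\ V y /\ forall z, U z -> V z -> False;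
  glocally_compact : forall x,
      exists U K, gopen U /\ U x /\ (forall z, U z -> K z) /\ is_compact gopen K
}.

Arguments gzero {_}.
Arguments gadd {_} _ _.
Arguments gopp {_} _.

Definition gsub {G : LCAGroup} (x y : G) : G := gadd x (gopp y).

Definition sigma_compact (G : LCAGroup) : Prop :=
  exists Kn : nat -> G -> Prop,
    (forall n, is_compact (gopen G) (Kn n)) /\ forall x, exists n, Kn n x.

Definition has_nonempty_interior (G : LCAGroup) (K : G -> Prop) : Prop :=
  exists U, gopen G U /\ (exists x, U x) /\ forall x, U x -> K x.

Definition relatively_dense (G : LCAGroup) (A : G -> Prop) : Prop :=
  exists K, is_compact (gopen G) K /\
    forall g, exists a k, A a /\ K k /\ g = gadd a k.

Definition diffset (G : LCAGroup) (A : G -> Prop) (x : G) : Prop :=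
  exists a b, A a /\ A b /\ x = gsub a b.

Definition locally_finite (G : LCAGroup) (A : G -> Prop) : Prop :=
  forall K, is_compact (gopen G) K -> exists l : list G, forall x, A x -> K x -> In x l.

Definition uniformly_discrete (G : LCAGroup) (A : G -> Prop) : Prop :=
  exists U, gopen G U /\ U gzero /\
    forall x y, A x -> A y -> U (gsub x y) -> x = y.

Definition finite_local_complexity (G : LCAGroup) (A : G -> Prop) : Prop :=
  locally_finite G (diffset G A).

Definition subgroup (G : LCAGroup) (S : G -> Prop) : Prop :=
  S gzero /\ (forall x y, S x -> S y -> S (gadd x y)) /\ (forall x, S x -> S (gopp x)).

Definition period_stable (G : LCAGroup) (L : G -> Prop) : Prop :=
  forall S, subgroup G S -> (forall h, S h -> diffset G L h) ->
    (forall h x, S h -> L x -> L (gadd h x)) /\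
    (forall x, L x -> exists h y, S h /\ L y /\ x = gadd h y).

Definition continuous_fun (G : LCAGroup) (f : G -> R) : Prop :=
  forall x eps, 0 < eps ->
    exists U, gopen G U /\ U x /\ forall y, U y -> Rabs (f y - f x) < eps.

Definition compact_support (G : LCAGroup) (f : G -> R) : Prop :=
  exists K, is_compact (gopen G) K /\ forall x, ~ K x -> f x = 0.

Definition sup_lt {X : Type} (g : X -> R) (eps : R) : Prop :=
  exists e', e' < eps /\ forall x, Rabs (g x) <= e'.

Definition bohr_ap (G : LCAGroup) (F : G -> R) : Prop :=
  continuous_fun G F /\
  forall eps, 0 < eps ->
    relatively_dense G (fun t => sup_lt (fun x => F (gadd x t) - F x) eps).

Fixpoint lsum {X : Type} (a : X -> R) (l : list X) : R :=
  match l with nil => 0 | x :: l' => a x + lsum a l' end.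

Definition HasSum {X : Type} (a : X -> R) (s : R) : Prop :=
  forall eps, 0 < eps -> exists l0 : list X,
    forall l, NoDup l -> incl l0 l -> Rabs (lsum a l - s) < eps.

(* ---------- discrete measures eta <= delta_Lambda ----------
   A positive measure eta with eta <= delta_Lambda is pure point, given by
   its weights w x = eta({x}), with 0 <= w <= 1 on Lambda and w = 0 off Lambda. *)
Definition pos_measure_below_delta (G : LCAGroup) (L : G -> Prop) (w : G -> R) : Prop :=
  (forall x, 0 <= w x) /\ (forall x, L x -> w x <= 1) /\ (forall x, ~ L x -> w x = 0).

Definition nonzero_measure (G : LCAGroup) (w : G -> R) : Prop := exists x, w x <> 0.

(* ||mu||_K < eps, for the pure point (signed) measure with weights v:
   sup_s |mu|(s + K) < eps *)
Definition normK_lt (G : LCAGroup) (K : G -> Prop) (v : G -> R) (eps : R) : Prop :=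
  exists e', e' < eps /\
    forall (s : G) (l : list G), NoDup l -> (forall x, In x l -> K (gsub x s)) ->
      lsum (fun x => Rabs (v x)) l <= e'.

(* T_t eta ({x}) = eta({x - t}) *)
Definition norm_ap (G : LCAGroup) (K : G -> Prop) (w : G -> R) : Prop :=
  forall eps, 0 < eps ->
    relatively_dense G (fun t => normK_lt G K (fun x => w x - w (gsub x t)) eps).

Definition sup_ap (G : LCAGroup) (w : G -> R) : Prop :=
  forall eps, 0 < eps ->
    relatively_dense G (fun t => sup_lt (fun x => w (gadd t x) - w x) eps).

Definition strongly_ap (G : LCAGroup) (w : G -> R) : Prop :=
  forall f : G -> R, continuous_fun G f -> compact_support G f ->
    exists F : G -> R,
      (forall x, HasSum (fun y => f (gsub x y) * w y) (F x)) /\ bohr_ap G F.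

Definition prod_open (G H : LCAGroup) (O : (G * H)%type -> Prop) : Prop :=
  forall p, O p -> exists U V, gopen G U /\ gopen H V /\ U (fst p) /\ V (snd p) /\
    forall a b, U a -> V b -> O (a, b).

Definition model_set (G : LCAGroup) (L : G -> Prop) : Prop :=
  exists (H : LCAGroup) (Lt : (G * H)%type -> Prop) (W : H -> Prop),
    Lt (gzero, gzero) /\
    (forall p q, Lt p -> Lt q -> Lt (gadd (fst p) (fst q), gadd (snd p) (snd q))) /\
    (forall p, Lt p -> Lt (gopp (fst p), gopp (snd p))) /\
    (exists O, prod_open G H O /\ O (gzero, gzero) /\
       forall p, Lt p -> O p -> p = (gzero, gzero)) /\
    (exists C, is_compact (prod_open G H) C /\
       forall p, exists c q, C c /\ Lt q /\
         p = (gadd (fst c) (fst q), gadd (snd c) (snd q))) /\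
    (forall p q, Lt p -> Lt q -> fst p = fst q -> p = q) /\
    (forall V, gopen H V -> (exists h, V h) -> exists p, Lt p /\ V (snd p)) /\
    is_compact (gopen H) (closure (gopen H) W) /\
    has_nonempty_interior H W /\
    (forall x, L x <-> exists h, Lt (x, h) /\ W h).

(* Main.v *)
(** A model set with window [W] carries the weights [f h] at [x], for [(x, h)] in
    the lattice, where [f] is a uniformly continuous bump below the indicator of
    [W]; lattice points with small second component give almost periods.

    Conversely, let [w] be sup-almost periodic weights below [L].  An almost period
    [t] with error less than [w x0] moves [x0] inside [L], hence lies in [L - L],
    which is locally finite.  So in the sup-norm closure [H] of the translates of
    [w] small balls are totally bounded, [H] is a locally compact group, and the
    pairs [(x, T_x w)] with [x] ranging over all of [G] form a lattice in [G * H].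
    Two points with the same translate differ by a period of [w]; the periods form
    a subgroup inside [L - L], so by period-stability [L] is exactly the set of [x]
    with [T_x w] in the image of [L]. *)

Require Import Defs.
From Stdlib Require Import Reals List Classical Lra Lia Permutation Arith.
From Stdlib Require Import ClassicalEpsilon FunctionalExtensionality.
From Stdlib Require Import PropExtensionality ProofIrrelevance.
Import ListNotations.
Open Scope R_scope.

(** Taking the graph of [hull_of] over all of G as lattice makes the first projection injective and
    the second dense by construction, and a kernel of [hull_of] does no harm. The work lies in
    discreteness and compactness, where the constants are chosen so that accumulated errors stay
    below [w x0]. The image of L in the hull may have empty interior; the window therefore also
    contains an open set, on which an extension of w to the hull is positive. Elements of the hull
    are limits of translates of w and no longer translations, so their sum must be built from sums
    of approximating translations; invariance of the sup norm under translation makes the result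
    independent of the approximations. Norm and sup almost periodicity agree because a translate of
    K contains a bounded number of points of L. For strong almost periodicity the danger is that
    smoothing mixes several points. Uniform discreteness of L - L permits a bump so narrow that
    every value of the convolution has at most one nonzero term, from which the weights can be read
    off. *)

Inductive gexpr : Type :=
| GVar (n : nat) | GZero | GAdd (a b : gexpr) | GOpp (a : gexpr).

(** * Identities in abelian groups, decided by reflection *)

Section Abel.
Variables (G : LCAGroup) (env : list G).

Fixpoint geval (e : gexpr) : G :=
  match e with
  | GVar n => nth n env gzero
  | GZero => gzero
  | GAdd a b => gadd (geval a) (geval b)
  | GOpp a => gopp (geval a)
  end.

(** An element of the free abelian group as a formal difference of two multisets: positive and
    negative occurrences. *)
Fixpoint gatoms (e : gexpr) : list nat * list nat :=
  match e with
  | GVar n => ([n], [])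
  | GZero => ([], [])
  | GAdd a b => (fst (gatoms a) ++ fst (gatoms b), snd (gatoms a) ++ snd (gatoms b))
  | GOpp a => (snd (gatoms a), fst (gatoms a))
  end.

Definition gsum (l : list nat) : G :=
  fold_right (fun n acc => gadd (nth n env gzero) acc) gzero l.

Lemma gaddCA (x y z : G) : gadd x (gadd y z) = gadd y (gadd x z).
Proof. now rewrite gaddA, (gaddC G x y), <- gaddA. Qed.

Lemma gadd_cancel (x y z : G) : gadd x y = gadd x z -> y = z.
Proof.
intros E. rewrite <- (gadd0 G y), <- (gadd0 G z), <- (gaddN G x).
now rewrite <- !gaddA, E.
Qed.

Lemma gsum_app l m : gsum (l ++ m) = gadd (gsum l) (gsum m).
Proof.
induction l as [|n l IH]; simpl; [now rewrite gadd0|].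
now rewrite IH, gaddA.
Qed.

Lemma gsum_perm l m : Permutation l m -> gsum l = gsum m.
Proof.
induction 1; simpl; try congruence.
apply gaddCA.
Qed.

Lemma geval_atoms e : gadd (gsum (snd (gatoms e))) (geval e) = gsum (fst (gatoms e)).
Proof.
induction e as [n| |a IHa b IHb|a IHa]; simpl.
- now rewrite gaddC, (gaddC G _ gzero).
- now rewrite gadd0.
- rewrite !gsum_app, <- IHa, <- IHb, <- !gaddA. f_equal. apply gaddCA.
- rewrite <- IHa, <- gaddA, (gaddC G (geval a)), gaddN.
  now rewrite gaddC, gadd0.
Qed.

(** Formal differences agree when the crosswise sums do, as for integers built from pairs of
    naturals. Only indices that occur need to be counted. *)
Definition gcheck (e1 e2 : gexpr) : bool :=
  let l := fst (gatoms e1) ++ snd (gatoms e2) in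
  let m := fst (gatoms e2) ++ snd (gatoms e1) in
  forallb (fun n => Nat.eqb (count_occ Nat.eq_dec l n) (count_occ Nat.eq_dec m n)) (l ++ m).

Lemma gcheck_sound e1 e2 : gcheck e1 e2 = true -> geval e1 = geval e2.
Proof.
unfold gcheck. set (l := _ ++ _). set (m := fst (gatoms e2) ++ _).
intros C. rewrite forallb_forall in C.
assert (P : Permutation l m).
{ apply (Permutation_count_occ Nat.eq_dec). intros n.
  destruct (in_dec Nat.eq_dec n (l ++ m)) as [i|i].
  - now apply Nat.eqb_eq, C.
  - rewrite in_app_iff in i.
    rewrite (proj1 (count_occ_not_In Nat.eq_dec l n)) by tauto.
    now rewrite (proj1 (count_occ_not_In Nat.eq_dec m n)) by tauto. }
apply gsum_perm in P. unfold l, m in P.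
rewrite !gsum_app, <- !geval_atoms in P.
apply (gadd_cancel (gadd (gsum (snd (gatoms e1))) (gsum (snd (gatoms e2))))).
rewrite <- !gaddA, (gaddC G (gsum (snd (gatoms e2))) (geval e1)), gaddA, P.
now rewrite (gaddC G _ (gsum (snd (gatoms e1)))).
Qed.
End Abel.

Ltac abel_mem x l :=
  lazymatch l with
  | nil => constr:(false)
  | cons x _ => constr:(true)
  | cons _ ?t => abel_mem x t
  end.
Ltac abel_env t l :=
  lazymatch t with
  | gadd ?a ?b => let l1 := abel_env a l in abel_env b l1
  | gopp ?a => abel_env a l
  | gzero => l
  | _ => match abel_mem t l with true => l | false => constr:(cons t l) end
  end.
Ltac abel_pos x l :=
  lazymatch l with
  | cons x _ => constr:(O)
  | cons _ ?t => let n := abel_pos x t in constr:(S n)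
  end.
Ltac abel_reify t l :=
  lazymatch t with
  | gadd ?a ?b => let u := abel_reify a l in let v := abel_reify b l in constr:(GAdd u v)
  | gopp ?a => let u := abel_reify a l in constr:(GOpp u)
  | gzero => constr:(GZero)
  | _ => let n := abel_pos t l in constr:(GVar n)
  end.
Ltac abel :=
  intros; unfold gsub;
  lazymatch goal with
  | |- @eq ?T ?a ?b =>
    lazymatch type of a with
    | car ?G =>
      let l0 := abel_env a (@nil (car G)) in
      let l := abel_env b l0 in
      let u := abel_reify a l in
      let v := abel_reify b l in
      exact (gcheck_sound G l u v eq_refl)
    end
  end.

Lemma gsub_eq0 (G : LCAGroup) (x y : G) : gsub x y = gzero -> x = y.
Proof.
intros E. replace x with (gadd (gsub x y) y) by abel. rewrite E. abel.
Qed.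

(** * Neighbourhoods of zero *)

(** Such an A is the union of all open sets contained in it. *)
Lemma gopen_local (G : LCAGroup) (A : G -> Prop) :
  (forall x, A x -> exists U, gopen G U /\ U x /\ forall y, U y -> A y) -> gopen G A.
Proof.
intros HA.
replace A with (fun x => exists U, (gopen G U /\ forall y, U y -> A y) /\ U x).
- apply gopen_union. now intros U [].
- extensionality x. apply propositional_extensionality. split.
  + intros (U & [_ S] & Ux). auto.
  + intros Ax. destruct (HA x Ax) as (U & o & Ux & S). exists U. auto.
Qed.

Lemma gopen_translate (G : LCAGroup) (U : G -> Prop) (c : G) :
  gopen G U -> gopen G (fun x => U (gadd x c)).
Proof.
intros o. apply gopen_local. intros x Ux.
destruct (gadd_cont G x c U o Ux) as (V & W & oV & oW & Vx & Wc & S).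
exists V. auto.
Qed.

Lemma gopen_opp (G : LCAGroup) (U : G -> Prop) :
  gopen G U -> gopen G (fun x => U (gopp x)).
Proof.
intros o. apply gopen_local. intros x Ux. now apply gopp_cont.
Qed.

Lemma nbhd_half (G : LCAGroup) (U : G -> Prop) :
  gopen G U -> U gzero ->
  exists V, gopen G V /\ V gzero /\ (forall x, V x -> V (gopp x)) /\
    forall x y, V x -> V y -> U (gadd x y).
Proof.
intros o U0. rewrite <- (gadd0 G gzero) in U0.
destruct (gadd_cont G _ _ U o U0) as (A & B & oA & oB & A0 & B0 & S).
assert (opp0 : gopp (@gzero G) = gzero) by abel.
exists (fun x => (A x /\ B x) /\ (A (gopp x) /\ B (gopp x))). repeat split; try tauto.
- apply gopen_inter; [now apply gopen_inter|].
  apply gopen_inter; now apply gopen_opp.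
- now rewrite opp0.
- now rewrite opp0.
- replace (gopp (gopp x)) with x by abel. tauto.
- replace (gopp (gopp x)) with x by abel. tauto.
- intros x y [[] _] [[] _]. auto.
Qed.

Lemma nbhd_sub (G : LCAGroup) (U : G -> Prop) :
  gopen G U -> U gzero ->
  exists V, gopen G V /\ V gzero /\ (forall x, V x -> V (gopp x)) /\
    forall x y, V x -> V y -> U (gsub x y).
Proof.
intros o U0. destruct (nbhd_half G U o U0) as (V & oV & V0 & sV & S).
exists V. repeat split; trivial. intros x y Vx Vy. apply S; auto.
Qed.

Lemma compact_nbhd0 (G : LCAGroup) :
  exists U N, gopen G U /\ U gzero /\ (forall x, U x -> N x) /\ is_compact (gopen G) N.
Proof.
destruct (glocally_compact G gzero) as (U & N & H). exists U, N. exact H.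
Qed.

(** Finite choice. The second half keeps stray entries out of m, which matters when m has to be a
    finite subfamily of a cover. *)
Lemma list_choice {A B : Type} (P : A -> B -> Prop) (l : list A) :
  (forall a, In a l -> exists b, P a b) ->
  exists m, (forall a, In a l -> exists b, In b m /\ P a b) /\
            (forall b, In b m -> exists a, In a l /\ P a b).
Proof.
induction l as [|a l IH]; intros H.
- exists []. split; now intros ? [].
- destruct (H a (or_introl eq_refl)) as [b Pab].
  destruct IH as (m & H1 & H2); [intros; apply H; now right|].
  exists (b :: m). split.
  + intros x [<-|i]; [exists b; simpl; auto|].
    destruct (H1 x i) as (y & ? & ?). exists y. simpl. auto.
  + intros y [<-|i]; [exists a; simpl; auto|].
    destruct (H2 y i) as (x & ? & ?). exists x. simpl. auto.
Qed.

(** * Totally bounded sets *)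

(** A working substitute for relative compactness: it passes to subsets and differences by handling
    finite lists of centres, and local compactness converts it back into a compact superset. *)
Definition totally_bounded (G : LCAGroup) (A : G -> Prop) : Prop :=
  forall U, gopen G U -> U gzero ->
    exists l : list G, forall x, A x -> exists c, In c l /\ U (gsub x c).

Lemma compact_totally_bounded (G : LCAGroup) (A : G -> Prop) :
  is_compact (gopen G) A -> totally_bounded G A.
Proof.
intros cA U oU U0.
destruct (cA (fun V => exists c, V = fun x => U (gsub x c))) as (l & H1 & H2).
- intros V [c ->]. now apply gopen_translate.
- intros x _. exists (fun y => U (gsub y x)). split; [now exists x|].
  now replace (gsub x x) with (@gzero G) by abel.
- destruct (list_choice _ l H1) as (m & H3 & _). exists m. intros x Ax.
  destruct (H2 x Ax) as (V & iV & Vx). destruct (H3 V iV) as (c & ic & ->). now exists c.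
Qed.

Lemma totally_bounded_sub (G : LCAGroup) (A B : G -> Prop) :
  totally_bounded G A -> totally_bounded G B ->
  totally_bounded G (fun x => exists a b, A a /\ B b /\ x = gsub a b).
Proof.
intros tA tB U oU U0. destruct (nbhd_sub G U oU U0) as (V & oV & V0 & _ & S).
destruct (tA V oV V0) as [l Hl]. destruct (tB V oV V0) as [m Hm].
exists (flat_map (fun c => map (gsub c) m) l).
intros x (a & b & Aa & Bb & ->).
destruct (Hl a Aa) as (c & ic & Vc). destruct (Hm b Bb) as (d & id & Vd).
exists (gsub c d). split.
- apply in_flat_map. exists c. split; trivial. now apply in_map.
- replace (gsub (gsub a b) (gsub c d)) with (gsub (gsub a c) (gsub b d)) by abel. auto.
Qed.

Lemma totally_bounded_mono (G : LCAGroup) (A B : G -> Prop) :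
  (forall x, A x -> B x) -> totally_bounded G B -> totally_bounded G A.
Proof.
intros S tB U oU U0. destruct (tB U oU U0) as [l Hl]. exists l. auto.
Qed.

Lemma totally_bounded_opp (G : LCAGroup) (A : G -> Prop) :
  totally_bounded G A -> totally_bounded G (fun x => A (gopp x)).
Proof.
intros tA U oU U0.
assert (U0' : U (gopp gzero)) by now replace (gopp gzero) with (@gzero G) by abel.
destruct (tA _ (gopen_opp G U oU) U0') as [l Hl].
exists (map gopp l). intros x Ax. destruct (Hl _ Ax) as (c & ic & Uc).
exists (gopp c). split; [now apply in_map|].
now replace (gsub x (gopp c)) with (gopp (gsub (gopp x) c)) by abel.
Qed.

Lemma totally_bounded_list (G : LCAGroup) (l : list G) :
  totally_bounded G (fun x => In x l).
Proof.
intros U _ U0. exists l. intros x i. exists x. split; trivial.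
now replace (gsub x x) with (@gzero G) by abel.
Qed.

Lemma compact_translate (G : LCAGroup) (A : G -> Prop) (c : G) :
  is_compact (gopen G) A -> is_compact (gopen G) (fun x => A (gsub x c)).
Proof.
intros cA F oF cov.
destruct (cA (fun V => exists U, F U /\ V = fun x => U (gadd x c))) as (l & H1 & H2).
- intros V (U & FU & ->). apply gopen_translate. auto.
- intros x Ax. destruct (cov (gadd x c)) as (U & FU & Ux).
  + now replace (gsub (gadd x c) c) with x by abel.
  + exists (fun y => U (gadd y c)). split; trivial. now exists U.
- destruct (list_choice _ l H1) as (m & H3 & H4). exists m. split.
  + intros U iU. now destruct (H4 U iU) as (V & _ & FU & _).
  + intros x Ax. destruct (H2 _ Ax) as (V & iV & Vx).
    destruct (H3 V iV) as (U & iU & _ & ->). exists U. split; trivial.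
    now replace (gadd (gsub x c) c) with x in Vx by abel.
Qed.

Lemma compact_list_union {X Y : Type} (op : (X -> Prop) -> Prop) (A : Y -> X -> Prop) l :
  (forall c, In c l -> is_compact op (A c)) ->
  is_compact op (fun x => exists c, In c l /\ A c x).
Proof.
intros cA F oF cov. induction l as [|c l IH].
- exists []. split; [now intros ? []|]. now intros x (? & [] & _).
- destruct (cA c (or_introl eq_refl) F oF) as (l1 & H1 & H2).
  { intros x Ax. apply cov. exists c. simpl. auto. }
  destruct IH as (l2 & H3 & H4).
  { intros d id. apply cA. now right. }
  { intros x (d & id & Ad). apply cov. exists d. simpl. auto. }
  exists (l1 ++ l2). split.
  + intros U i. apply in_app_or in i. destruct i; auto.
  + intros x (d & [<-|id] & Ad).
    * destruct (H2 x Ad) as (U & iU & Ux). exists U. rewrite in_app_iff. auto.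
    * destruct (H4 x) as (U & iU & Ux); [now exists d|]. exists U. rewrite in_app_iff. auto.
Qed.

(** Finitely many translates of one compact neighbourhood of zero cover A. *)
Lemma totally_bounded_compact (G : LCAGroup) (A : G -> Prop) :
  totally_bounded G A -> exists K, is_compact (gopen G) K /\ forall x, A x -> K x.
Proof.
intros tA. destruct (compact_nbhd0 G) as (U & N & oU & U0 & S & cN).
destruct (tA U oU U0) as [l Hl].
exists (fun x => exists c, In c l /\ N (gsub x c)). split.
- apply (compact_list_union (gopen G) (fun c x => N (gsub x c))).
  intros c _. now apply compact_translate.
- intros x Ax. destruct (Hl x Ax) as (c & ic & Uc). exists c. auto.
Qed.

Lemma relatively_dense_tb (G : LCAGroup) (A B : G -> Prop) :
  totally_bounded G B -> (forall g, exists a, A a /\ B (gsub g a)) -> relatively_dense G A.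
Proof.
intros tB H. destruct (totally_bounded_compact G B tB) as (K & cK & S).
exists K. split; trivial. intros g. destruct (H g) as (a & Aa & Ba).
exists a, (gsub g a). repeat split; auto. abel.
Qed.

Lemma relatively_dense_mono (G : LCAGroup) (A B : G -> Prop) :
  (forall x, A x -> B x) -> relatively_dense G A -> relatively_dense G B.
Proof.
intros S (K & cK & H). exists K. split; trivial. intros g.
destruct (H g) as (a & k & ? & ? & ?). exists a, k. auto.
Qed.

(** * Finite and uniformly discrete sets *)

(** Pigeonhole: each box holds at most one point of A. The bound on the length is what later gives
    counts that are uniform under translation. *)
Lemma finite_boxes {X Y : Type} (A : X -> Prop) (R : Y -> X -> Prop) (cs : list Y) :
  (forall x, A x -> exists c, In c cs /\ R c x) ->
  (forall c x y, A x -> A y -> R c x -> R c y -> x = y) ->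
  exists l, (length l <= length cs)%nat /\ forall x, A x -> In x l.
Proof.
revert A. induction cs as [|c cs IH]; intros A cov inj.
- exists []. split; trivial. intros x Ax. now destruct (cov x Ax) as (? & [] & _).
- destruct (IH (fun x => A x /\ ~ R c x)) as (l & len & H).
  + intros x [Ax nR]. destruct (cov x Ax) as (d & [<-|id] & Rd); [easy|]. now exists d.
  + intros d x y [] []. eauto.
  + destruct (classic (exists x, A x /\ R c x)) as [(x & Ax & Rx)|no].
    * exists (x :: l). split; [simpl; lia|]. intros y Ay.
      destruct (classic (R c y)) as [Ry|nR]; [left; eauto|right; auto].
    * exists l. split; [simpl; lia|]. intros y Ay. apply H. split; trivial. eauto.
Qed.

Lemma nbhd_avoid_list (G : LCAGroup) (l : list G) :
  exists U, gopen G U /\ U gzero /\ forall x, In x l -> U x -> x = gzero.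
Proof.
induction l as [|c l (U & oU & U0 & H)].
- exists (fun _ => True). repeat split; [apply gopen_full|now intros ? []].
- destruct (classic (c = gzero)) as [->|nc].
  + exists U. repeat split; trivial. intros x [<-|i]; auto.
  + destruct (ghausdorff G c gzero nc) as (A & B & oA & oB & Ac & B0 & D).
    exists (fun x => U x /\ B x). repeat split; trivial; [now apply gopen_inter|].
    intros x [<-|i] [Ux Bx]; [now destruct (D c)|auto].
Qed.

Lemma locally_finite_isolated0 (G : LCAGroup) (A : G -> Prop) :
  locally_finite G A ->
  exists U, gopen G U /\ U gzero /\ forall x, A x -> U x -> x = gzero.
Proof.
intros lf. destruct (compact_nbhd0 G) as (U & N & oU & U0 & S & cN).
destruct (lf N cN) as [l Hl]. destruct (nbhd_avoid_list G l) as (V & oV & V0 & HV).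
exists (fun x => U x /\ V x). repeat split; trivial; [now apply gopen_inter|].
intros x Ax [Ux Vx]. auto.
Qed.

Lemma flc_uniformly_discrete (G : LCAGroup) (L : G -> Prop) :
  finite_local_complexity G L -> uniformly_discrete G L.
Proof.
intros flc. destruct (locally_finite_isolated0 G _ flc) as (U & oU & U0 & HU).
exists U. repeat split; trivial. intros x y Lx Ly Uxy. apply gsub_eq0, HU; trivial.
now exists x, y.
Qed.

(** A is covered by boxes so small that a translate of a box meets L at most once. Their number does
    not depend on s, hence neither does N. *)
Lemma uniformly_discrete_count (G : LCAGroup) (L A : G -> Prop) :
  uniformly_discrete G L -> totally_bounded G A ->
  exists N : nat, forall s, exists l, (length l <= N)%nat /\
    forall x, L x -> A (gsub x s) -> In x l.
Proof.
intros (U & oU & U0 & HU) tA. destruct (nbhd_sub G U oU U0) as (V & oV & V0 & _ & S).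
destruct (tA V oV V0) as [cs Hcs]. exists (length cs). intros s.
destruct (finite_boxes (fun x => L x /\ A (gsub x s))
            (fun c x => V (gsub (gsub x s) c)) cs) as (l & len & H).
- intros x [_ Ax]. auto.
- intros c x y [Lx _] [Ly _] Vx Vy. apply HU; trivial.
  replace (gsub x y) with (gsub (gsub (gsub x s) c) (gsub (gsub y s) c)) by abel. auto.
- exists l. auto.
Qed.

Lemma uniformly_discrete_locally_finite (G : LCAGroup) (A : G -> Prop) :
  uniformly_discrete G A -> locally_finite G A.
Proof.
intros ud K cK.
destruct (uniformly_discrete_count G A K ud (compact_totally_bounded G K cK)) as [N HN].
destruct (HN gzero) as (l & _ & Hl). exists l. intros x Ax Kx. apply Hl; trivial.
now replace (gsub x gzero) with x by abel.
Qed.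
(** * Uniformly continuous bump functions *)

Lemma Rabs_bounds a b : Rabs a <= b -> - b <= a <= b.
Proof. unfold Rabs. destruct (Rcase_abs a); lra. Qed.

(** Helly's theorem on the line: the supremum of the left ends lies in every interval. It serves as
    completeness for families over any index type, without extracting a Cauchy sequence. *)
Lemma intervals_common_point {I : Type} (i0 : I) (c r : I -> R) :
  (forall i j, Rabs (c i - c j) <= r i + r j) -> exists z, forall i, Rabs (z - c i) <= r i.
Proof.
intros H.
destruct (completeness (fun y => exists i, y = c i - r i)) as [z [ub lub]].
- exists (c i0 + r i0). intros y [i ->]. generalize (H i i0).
  unfold Rabs. destruct (Rcase_abs _); lra.
- exists (c i0 - r i0). now exists i0.
- exists z. intros i. apply Rabs_le. split.
  + assert (c i - r i <= z) by (apply ub; now exists i). lra.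
  + assert (z <= c i + r i); [|lra]. apply lub. intros y [j ->]. generalize (H i j).
    unfold Rabs. destruct (Rcase_abs _); lra.
Qed.

Lemma pow_half_pos k : 0 < (/ 2) ^ k.
Proof. apply pow_lt. lra. Qed.

Lemma pow_half_small eps : 0 < eps -> exists k, (/ 2) ^ k < eps.
Proof.
intros e. destruct (pow_lt_1_zero (/ 2)) with (y := eps) as [N HN]; trivial.
- rewrite Rabs_pos_eq; lra.
- exists N. specialize (HN N (le_n N)). rewrite Rabs_pos_eq in HN; trivial.
  apply Rlt_le, pow_half_pos.
Qed.

Lemma halving_cauchy (x : nat -> R) :
  (forall k, Rabs (x (S k) - x k) <= (/ 2) ^ S k) ->
  forall k l, Rabs (x k - x l) <= (/ 2) ^ k + (/ 2) ^ l.
Proof.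
intros H.
assert (D : forall k d, Rabs (x (d + k)%nat - x k) <= (/ 2) ^ k - (/ 2) ^ (d + k)).
{ intros k d. induction d as [|d IH]; simpl.
  - rewrite Rminus_diag, Rabs_R0. lra.
  - replace (x (S (d + k)) - x k)
      with ((x (S (d + k)) - x (d + k)%nat) + (x (d + k)%nat - x k)) by ring.
    eapply Rle_trans; [apply Rabs_triang|]. specialize (H (d + k)%nat). simpl in H. lra. }
assert (M : forall k l, (k <= l)%nat -> Rabs (x l - x k) <= (/ 2) ^ k + (/ 2) ^ l).
{ intros k l le. specialize (D k (l - k)%nat). replace (l - k + k)%nat with l in D by lia.
  generalize (pow_half_pos l). lra. }
intros k l. destruct (Nat.le_ge_cases k l).
- rewrite Rabs_minus_sym. auto.
- rewrite Rplus_comm. auto.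
Qed.

Lemma nat_least (P : nat -> Prop) :
  (exists n, P n) -> exists n, P n /\ forall m, P m -> (n <= m)%nat.
Proof.
intros [n Pn]. induction n as [n IH] using (well_founded_induction lt_wf).
destruct (classic (exists m, P m /\ (m < n)%nat)) as [(m & Pm & lt)|no].
- now apply (IH m).
- exists n. split; trivial. intros m Pm. apply Nat.nlt_ge. eauto.
Qed.

Lemma nbhd_halving_sequence (G : LCAGroup) (U : G -> Prop) :
  gopen G U -> U gzero ->
  exists V : nat -> G -> Prop, V O = U /\
    forall n, gopen G (V n) /\ V n gzero /\ (forall x, V (S n) x -> V (S n) (gopp x)) /\
      forall x y, V (S n) x -> V (S n) y -> V n (gadd x y).
Proof.
intros oU U0.
set (half := fun U V => gopen G V /\ V gzero /\ (forall x, V x -> V (gopp x)) /\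
               forall x y, V x -> V y -> U (gadd x y)).
(* The default [fun _ => True] is never what counts: [half] is satisfiable at every stage, as the
   induction below shows. *)
set (V := fix V n := match n with
            | O => U
            | S n' => epsilon (inhabits (fun _ => True)) (half (V n')) end).
assert (E : forall n, half (V n) (V (S n)) /\ gopen G (V n) /\ V n gzero).
{ induction n as [|n (IH & o & z)].
  - repeat split; trivial; apply (epsilon_spec (inhabits _) (half U)), nbhd_half; trivial.
  - destruct IH as (o' & z' & _). split; [|now split].
    change (half (V (S n)) (epsilon (inhabits (fun _ => True)) (half (V (S n))))).
    apply epsilon_spec, nbhd_half; trivial. }
exists V. split; trivial. intros n. destruct (E n) as ((? & ? & ? & ?) & ? & ?). auto.
Qed.

Section Dyadic.
Variables (G : LCAGroup) (V : nat -> G -> Prop).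
Hypothesis V0 : forall n, V n gzero.
Hypothesis Vopp : forall n x, V (S n) x -> V (S n) (gopp x).
Hypothesis Vadd : forall n x y, V (S n) x -> V (S n) y -> V n (gadd x y).

(* The sublevel set at the dyadic number [j / 2 ^ k] in Urysohn's construction:
   the sum of the [V i] over the binary digits of [j / 2 ^ k], and everything
   from [1] on. *)
Fixpoint dyadic_set (k j : nat) (h : G) : Prop :=
  match k with
  | O => j = O -> h = gzero
  | S k' =>
    if Nat.even j then dyadic_set k' (Nat.div2 j) h
    else exists a v, dyadic_set k' (Nat.div2 j) a /\ V (S k') v /\ h = gadd a v
  end.

Lemma dyadic_set_even k i h : dyadic_set (S k) (2 * i) h = dyadic_set k i h.
Proof.
cbn [dyadic_set]. rewrite Nat.even_mul, Nat.div2_double. reflexivity.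
Qed.

Lemma dyadic_set_odd k i h :
  dyadic_set (S k) (S (2 * i)) h =
  exists a v, dyadic_set k i a /\ V (S k) v /\ h = gadd a v.
Proof.
cbn [dyadic_set]. rewrite Nat.even_succ, Nat.odd_mul, Nat.div2_succ_double. reflexivity.
Qed.

Lemma nat_even_odd j : exists i, j = (2 * i)%nat \/ j = S (2 * i).
Proof. destruct (Nat.Even_or_Odd j) as [[i E]|[i E]]; exists i; lia. Qed.

(** Adding [1 / 2 ^ k] with carry: for an odd index the last digit and the new summand merge,
    because two elements of [V (S k)] add up to one of [V k]. At k = 0 the target index is positive,
    so nothing is claimed. *)
Lemma dyadic_set_step k j a v :
  dyadic_set k j a -> V k v -> dyadic_set k (S j) (gadd a v).
Proof.
revert j a v. induction k as [|k IH]; intros j a v; [easy|].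
destruct (nat_even_odd j) as [i [->| ->]].
- rewrite dyadic_set_even, dyadic_set_odd. intros Da Vv. now exists a, v.
- rewrite dyadic_set_odd. replace (S (S (2 * i))) with (2 * S i)%nat by lia.
  rewrite dyadic_set_even. intros (b & u & Db & Vu & ->) Vv.
  replace (gadd (gadd b u) v) with (gadd b (gadd u v)) by abel. auto.
Qed.

Lemma dyadic_set_mono k i j a : (i <= j)%nat -> dyadic_set k i a -> dyadic_set k j a.
Proof.
induction 1 as [|j _ IH]; trivial. intros D.
replace a with (gadd a gzero) by abel. apply dyadic_set_step; auto.
Qed.

Lemma dyadic_set_full k h : dyadic_set k (2 ^ k) h.
Proof.
induction k as [|k IH]; [easy|]. now rewrite Nat.pow_succ_r', dyadic_set_even.
Qed.

Lemma dyadic_set_zero k : dyadic_set k 0 gzero.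
Proof.
induction k as [|k IH]; [easy|]. now rewrite (dyadic_set_even k 0).
Qed.

Lemma dyadic_set_coarsen k i j h :
  (j <= 2 * i)%nat -> dyadic_set (S k) j h -> dyadic_set k i h.
Proof.
intros le. destruct (nat_even_odd j) as [m [->| ->]].
- rewrite dyadic_set_even. apply dyadic_set_mono. lia.
- rewrite dyadic_set_odd. intros (a & v & Da & Vv & ->).
  apply (dyadic_set_mono k (S m)); [lia|]. apply dyadic_set_step; trivial.
  replace v with (gadd v gzero) by abel. auto.
Qed.

(** [phi h] is the limit of [lev k h / 2 ^ k], where [lev k h] is the least index whose set contains
    h, and it lies within [1 / 2 ^ k] of this term. So level 2 gives at most 1/4 at zero, and
    outside [V O] level 1 gives at least 1 - 1/2. *)
Lemma urysohn_level :
  exists phi : G -> R,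
    phi gzero <= / 4 /\ (forall x, ~ V O x -> / 2 <= phi x) /\
    forall k x v, V (S k) v -> Rabs (phi (gadd x v) - phi x) <= 3 * (/ 2) ^ S k.
Proof.
assert (ex : forall k h, exists j, dyadic_set k j h /\
                forall i, dyadic_set k i h -> (j <= i)%nat).
{ intros k h. apply nat_least. exists (2 ^ k)%nat. apply dyadic_set_full. }
set (lev := fun k h => proj1_sig (constructive_indefinite_description _ (ex k h))).
assert (lev1 : forall k h, dyadic_set k (lev k h) h).
{ intros k h. unfold lev. now destruct constructive_indefinite_description as [j []]. }
assert (lev2 : forall k h i, dyadic_set k i h -> (lev k h <= i)%nat).
{ intros k h. unfold lev. now destruct constructive_indefinite_description as [j []]. }
clearbody lev.
set (x := fun h k => INR (lev k h) * (/ 2) ^ k).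
(* Refining the grid gives [lev (S k) h] equal to [2 * lev k h] or one less, so successive terms
   differ by at most [(/ 2) ^ S k]. *)
assert (ex2 : forall h, exists z, forall k, Rabs (z - x h k) <= (/ 2) ^ k).
{ intros h. apply (intervals_common_point O), halving_cauchy. intros k.
  assert (A : (lev (S k) h <= 2 * lev k h)%nat) by (apply lev2; now rewrite dyadic_set_even).
  assert (B : (2 * lev k h <= lev (S k) h + 1)%nat).
  { destruct (nat_even_odd (lev (S k) h)) as [i Hi].
    assert (lev k h <= (if Nat.even (lev (S k) h) then i else S i))%nat.
    { apply lev2, (dyadic_set_coarsen k _ (lev (S k) h)); trivial.
      destruct (Nat.even (lev (S k) h)) eqn:E; [|lia].
      destruct Hi as [Hi|Hi]; [lia|]. rewrite Hi, Nat.even_succ, Nat.odd_mul in E. easy. }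
    destruct Hi as [Hi|Hi]; rewrite Hi in *.
    - rewrite Nat.even_mul in H. simpl in H. lia.
    - destruct (Nat.even (S (2 * i))); lia. }
  apply le_INR in A, B. rewrite plus_INR, mult_INR in B. rewrite mult_INR in A.
  simpl INR in A, B. unfold x. simpl pow. generalize (pow_half_pos k). intros p.
  apply Rabs_le. nra. }
apply choice in ex2. destruct ex2 as [phi Hphi].
assert (bd : forall h k, x h k - (/ 2) ^ k <= phi h <= x h k + (/ 2) ^ k).
{ intros h k. generalize (Hphi h k). unfold Rabs. destruct (Rcase_abs _); lra. }
exists phi. repeat split.
- assert (E : lev 2%nat gzero = O).
  { generalize (lev2 2%nat gzero O (dyadic_set_zero 2)). lia. }
  destruct (bd gzero 2%nat) as [_ H]. unfold x in H. rewrite E in H. simpl in H. lra.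
- intros h nV.
  assert (le : (2 <= lev 1%nat h)%nat).
  { apply Nat.nlt_ge. intros lt. apply nV.
    assert (D : dyadic_set 1 1 h) by (apply (dyadic_set_mono 1 (lev 1%nat h)); auto; lia).
    rewrite (dyadic_set_odd 0 0) in D. destruct D as (a & v & Da & Vv & ->).
    rewrite (Da eq_refl), gaddC. auto. }
  apply le_INR in le. simpl INR in le at 1.
  destruct (bd h 1%nat) as [H _]. unfold x in H. simpl pow in H. lra.
(* Adding v changes the level by at most one, and each of the two values of [phi] has the
   approximation error of its grid: three times [(/ 2) ^ S k]. *)
- intros k h v Vv.
  assert (A : (lev (S k) (gadd h v) <= S (lev (S k) h))%nat)
    by (apply lev2, dyadic_set_step; auto).
  assert (B : (lev (S k) h <= S (lev (S k) (gadd h v)))%nat).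
  { apply lev2. replace h with (gadd (gadd h v) (gopp v)) at 2 by abel.
    apply dyadic_set_step; auto. }
  apply le_INR in A, B. rewrite S_INR in A, B.
  generalize (bd h (S k)) (bd (gadd h v) (S k)) (pow_half_pos (S k)). unfold x.
  generalize ((/ 2) ^ S k). intros p b1 b2 pp. apply Rabs_le. nra.
Qed.
End Dyadic.

Definition clip01 (x : R) : R := Rmin 1 (Rmax 0 x).

Lemma clip01_lipschitz x y : Rabs (clip01 x - clip01 y) <= Rabs (x - y).
Proof.
unfold clip01, Rmin, Rmax, Rabs.
repeat destruct (Rle_dec _ _); repeat destruct (Rcase_abs _); lra.
Qed.

Lemma bump_exists (G : LCAGroup) (U : G -> Prop) :
  gopen G U -> U gzero ->
  exists f : G -> R, (forall x, 0 <= f x <= 1) /\ f gzero = 1 /\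
    (forall x, f x <> 0 -> U x) /\
    forall eps, 0 < eps -> exists V, gopen G V /\ V gzero /\
      forall v x, V v -> Rabs (f (gadd x v) - f x) <= eps.
Proof.
intros oU U0. destruct (nbhd_halving_sequence G U oU U0) as (V & <- & HV).
destruct (urysohn_level G V) as (phi & phi0 & phiout & phic); try apply HV.
(* The affine map sends 1/4 to 1 and 1/2 to 0. Its slope 4 times the factor 3 in the modulus of
   [phi] explains [eps / 12] below. *)
exists (fun x => clip01 (2 - 4 * phi x)). repeat split.
- unfold clip01, Rmin, Rmax. repeat destruct (Rle_dec _ _); lra.
- unfold clip01, Rmin, Rmax. repeat destruct (Rle_dec _ _); lra.
- unfold clip01, Rmin, Rmax. repeat destruct (Rle_dec _ _); lra.
- intros x nz. apply NNPP. intros nV. apply nz. specialize (phiout x nV).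
  unfold clip01, Rmin, Rmax. repeat destruct (Rle_dec _ _); lra.
- intros eps e. destruct (pow_half_small (eps / 12)) as [k Hk]; [lra|].
  exists (V (S k)). repeat split; try apply HV. intros v x Vv.
  eapply Rle_trans; [apply clip01_lipschitz|].
  replace (2 - 4 * phi (gadd x v) - (2 - 4 * phi x))
    with (- (4 * (phi (gadd x v) - phi x))) by ring.
  rewrite Rabs_Ropp, Rabs_mult, (Rabs_pos_eq 4) by lra.
  specialize (phic k x v Vv). simpl pow in phic. generalize (pow_half_pos k). lra.
Qed.
(** * Unordered sums *)

Lemma lsum_app {X} (a : X -> R) l m : lsum a (l ++ m) = lsum a l + lsum a m.
Proof. induction l as [|x l IH]; simpl; [ring|rewrite IH; ring]. Qed.

Lemma lsum_zero {X} (a : X -> R) l : (forall x, In x l -> a x = 0) -> lsum a l = 0.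
Proof.
induction l as [|x l IH]; simpl; trivial. intros H. rewrite H, IH; auto. ring.
Qed.

Lemma lsum_incl {X} (a : X -> R) l m :
  NoDup l -> NoDup m -> incl l m -> (forall x, In x m -> ~ In x l -> a x = 0) ->
  lsum a m = lsum a l.
Proof.
revert m. induction l as [|x l IH]; intros m nl nm inc zero.
- apply lsum_zero. auto.
- destruct (in_split x m) as (m1 & m2 & ->); [apply inc; now left|].
  inversion_clear nl as [|? ? nx nl'].
  assert (nm' := NoDup_remove_1 _ _ _ nm). assert (nxm := NoDup_remove_2 _ _ _ nm).
  assert (E : lsum a (m1 ++ m2) = lsum a l).
  { apply IH; trivial.
    - intros y i. assert (j := inc y (or_intror i)). apply in_app_or in j.
      apply in_or_app. destruct j as [|[<-|]]; auto. easy.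
    - intros y i n. apply zero.
      + apply in_app_or in i. apply in_or_app. simpl. tauto.
      + intros [->|]; auto. }
  rewrite lsum_app in *. simpl. lra.
Qed.

Lemma lsum_map {X Y} (a : Y -> R) (g : X -> Y) l :
  lsum a (map g l) = lsum (fun x => a (g x)) l.
Proof. induction l; simpl; congruence. Qed.

Lemma lsum_minus {X} (a b : X -> R) l : lsum (fun x => a x - b x) l = lsum a l - lsum b l.
Proof. induction l as [|x l IH]; simpl; [ring|rewrite IH; ring]. Qed.

Lemma Rabs_lsum {X} (a : X -> R) l : Rabs (lsum a l) <= lsum (fun x => Rabs (a x)) l.
Proof.
induction l as [|x l IH]; simpl; [rewrite Rabs_R0; lra|].
eapply Rle_trans; [apply Rabs_triang|lra].
Qed.

Lemma lsum_support_le {X} (a : X -> R) e l m :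
  0 <= e -> NoDup l -> (forall x, a x <= e) -> (forall x, In x l -> a x <> 0 -> In x m) ->
  lsum a l <= INR (length m) * e.
Proof.
intros e0 nl ae. revert m. induction l as [|x l IH]; intros m sup; simpl.
- apply Rmult_le_pos; trivial. apply pos_INR.
- inversion_clear nl as [|? ? nx nl'].
  destruct (Req_dec (a x) 0) as [E|nz].
  + rewrite E, Rplus_0_l. apply IH; trivial. intros; apply sup; trivial. now right.
  + destruct (in_split x m) as (m1 & m2 & ->); [apply sup; trivial; now left|].
    assert (H : lsum a l <= INR (length (m1 ++ m2)) * e).
    { apply IH; trivial. intros y i ny. assert (j := sup y (or_intror i) ny).
      apply in_app_or in j. apply in_or_app. destruct j as [|[<-|]]; auto. easy. }
    rewrite length_app in *. simpl length.
    rewrite Nat.add_succ_r, S_INR. specialize (ae x). lra.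
Qed.

Definition classic_dec {X : Type} (x y : X) : {x = y} + {x <> y} :=
  excluded_middle_informative (x = y).

Lemma HasSum_unique {X} (a : X -> R) s s' : HasSum a s -> HasSum a s' -> s = s'.
Proof.
intros H H'. apply NNPP. intros ne.
assert (p : 0 < Rabs (s - s') / 2).
{ assert (0 < Rabs (s - s')) by (apply Rabs_pos_lt; lra). lra. }
destruct (H _ p) as [l0 Hl]. destruct (H' _ p) as [l1 Hl1].
set (l := nodup classic_dec (l0 ++ l1)).
assert (A : Rabs (lsum a l - s) < Rabs (s - s') / 2).
{ apply Hl; [apply NoDup_nodup|]. intros x i. apply nodup_In, in_or_app. auto. }
assert (B : Rabs (lsum a l - s') < Rabs (s - s') / 2).
{ apply Hl1; [apply NoDup_nodup|]. intros x i. apply nodup_In, in_or_app. auto. }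
revert A B. unfold Rabs. repeat destruct (Rcase_abs _); lra.
Qed.

Lemma HasSum_finite {X} (a : X -> R) l :
  NoDup l -> (forall x, a x <> 0 -> In x l) -> HasSum a (lsum a l).
Proof.
intros nl sup eps e. exists l. intros m nm inc.
rewrite (lsum_incl a l m), Rminus_diag, Rabs_R0; trivial.
intros x _ n. apply NNPP. auto.
Qed.

Lemma HasSum_minus {X} (a b : X -> R) s s' :
  HasSum a s -> HasSum b s' -> HasSum (fun x => a x - b x) (s - s').
Proof.
intros H H' eps e. destruct (H (eps / 2)) as [l0 Hl]; [lra|].
destruct (H' (eps / 2)) as [l1 Hl1]; [lra|].
exists (l0 ++ l1). intros l nl inc. rewrite lsum_minus.
assert (A : Rabs (lsum a l - s) < eps / 2)
  by (apply Hl; trivial; intros x i; apply inc, in_or_app; auto).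
assert (B : Rabs (lsum b l - s') < eps / 2)
  by (apply Hl1; trivial; intros x i; apply inc, in_or_app; auto).
revert A B. unfold Rabs. repeat destruct (Rcase_abs _); lra.
Qed.

Lemma HasSum_shift (G : LCAGroup) (a : G -> R) s (t : G) :
  HasSum a s -> HasSum (fun y => a (gadd y t)) s.
Proof.
intros H eps e. destruct (H eps e) as [l0 Hl].
exists (map (fun y => gsub y t) l0). intros l nl inc.
rewrite <- (lsum_map a (fun y => gadd y t)). apply Hl.
- apply FinFun.Injective_map_NoDup; trivial. intros x y E.
  replace x with (gsub (gadd x t) t) by abel. rewrite E. abel.
- intros y i. apply in_map_iff. exists (gsub y t). split; [abel|].
  apply inc. now apply (in_map (fun y => gsub y t)).
Qed.

Lemma HasSum_support_le {X} (a : X -> R) s e m :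
  0 <= e -> HasSum a s -> (forall x, Rabs (a x) <= e) -> (forall x, a x <> 0 -> In x m) ->
  Rabs s <= INR (length m) * e.
Proof.
intros e0 H ae sup. set (l := nodup classic_dec m).
assert (nl : NoDup l) by apply NoDup_nodup.
rewrite (HasSum_unique a s (lsum a l)); trivial.
- eapply Rle_trans; [apply Rabs_lsum|]. apply lsum_support_le; trivial.
  intros x i _. now apply nodup_In in i.
- apply HasSum_finite; trivial. intros x nz. apply nodup_In. auto.
Qed.

(** * Sup-, norm- and strong almost periodicity *)

(** The difference of w and its translate lives on L and t + L, hence on at most 2N points of s +
    K. *)
Lemma norm_ap_of_sup_ap (G : LCAGroup) (L K : G -> Prop) (w : G -> R) :
  is_compact (gopen G) K -> uniformly_discrete G L -> (forall x, ~ L x -> w x = 0) ->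
  sup_ap G w -> norm_ap G K w.
Proof.
intros cK ud wL sap eps e.
destruct (uniformly_discrete_count G L K ud (compact_totally_bounded G K cK)) as [N HN].
assert (N0 := pos_INR N).
(* The added 1 covers N = 0 and keeps the final inequality strict. *)
set (d := eps / (2 * INR N + 1)).
assert (dE : d * (2 * INR N + 1) = eps) by (unfold d; field; lra).
assert (d0 : 0 < d) by (apply Rdiv_lt_0_compat; lra).
apply (relatively_dense_mono G _ _) with (2 := sap d d0).
intros t (e' & le & Ht).
assert (e'0 : 0 <= e') by (eapply Rle_trans; [apply Rabs_pos|apply (Ht gzero)]).
exists (2 * INR N * e'). split; [nra|]. intros s l nl Kl.
destruct (HN s) as (l1 & len1 & H1). destruct (HN (gsub s t)) as (l2 & len2 & H2).
apply Rle_trans with (INR (length (l1 ++ map (fun y => gadd y t) l2)) * e').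
- apply lsum_support_le; trivial.
  + intros x. replace x with (gadd t (gsub x t)) at 1 by abel. apply Ht.
  + intros x i nz. apply in_or_app.
    destruct (classic (L x)) as [Lx|nL]; [left; auto|right].
    destruct (classic (L (gsub x t))) as [Lx|nL'].
    * apply in_map_iff. exists (gsub x t). split; [abel|]. apply H2; trivial.
      replace (gsub (gsub x t) (gsub s t)) with (gsub x s) by abel. auto.
    * exfalso. apply nz. now rewrite (wL _ nL), (wL _ nL'), Rminus_diag, Rabs_R0.
- rewrite length_app, length_map, plus_INR.
  apply le_INR in len1, len2. apply Rmult_le_compat_r; lra.
Qed.

Lemma sup_ap_of_norm_ap (G : LCAGroup) (K : G -> Prop) (w : G -> R) k :
  K k -> norm_ap G K w -> sup_ap G w.
Proof.
intros Kk nap eps e. apply (relatively_dense_mono G _ _) with (2 := nap eps e).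
intros t (e' & le & Ht). exists e'. split; trivial. intros x.
(* The translate of K is placed so that k falls on t + x; this one point already bounds the
   difference there. *)
specialize (Ht (gsub (gadd t x) k) [gadd t x]).
simpl in Ht. replace (gsub (gadd t x) t) with x in Ht by abel. rewrite Rplus_0_r in Ht.
apply Ht.
- constructor; [now intros []|constructor].
- intros y [<-|[]]. now replace (gsub (gadd t x) (gsub (gadd t x) k)) with k by abel.
Qed.

Lemma compact_support_bounded (G : LCAGroup) (f : G -> R) :
  continuous_fun G f -> compact_support G f -> exists M, 0 <= M /\ forall x, Rabs (f x) <= M.
Proof.
intros cf (K & cK & supp).
destruct (cK (fun U => gopen G U /\ exists M, forall y, U y -> Rabs (f y) <= M))
  as (l & H1 & H2).
- now intros U [].
- intros x _. destruct (cf x 1) as (U & oU & Ux & HU); [lra|].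
  exists U. repeat split; trivial. exists (Rabs (f x) + 1). intros y Uy.
  specialize (HU y Uy). generalize (Rabs_triang_inv (f y) (f x)). lra.
- assert (H : exists M, 0 <= M /\ forall U y, In U l -> U y -> Rabs (f y) <= M).
  { clear H2. induction l as [|U l IH].
    - exists 0. split; [lra|]. now intros U y [].
    - destruct IH as (M & M0 & HM); [intros; apply H1; now right|].
      destruct (H1 U (or_introl eq_refl)) as (_ & M' & HM').
      exists (Rmax M M'). split; [generalize (Rmax_l M M'); lra|].
      intros V y [<-|i] Vy.
      + eapply Rle_trans; [now apply HM'|apply Rmax_r].
      + eapply Rle_trans; [now apply (HM V)|apply Rmax_l]. }
  destruct H as (M & M0 & HM). exists M. split; trivial. intros x.
  destruct (classic (K x)) as [Kx|nK].
  + destruct (H2 x Kx) as (U & iU & Ux). eauto.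
  + now rewrite (supp x nK), Rabs_R0.
Qed.

Definition continuous_at (G : LCAGroup) (f : G -> R) (x : G) : Prop :=
  forall eps, 0 < eps -> exists U, gopen G U /\ U x /\ forall y, U y -> Rabs (f y - f x) < eps.

Lemma lsum_continuous_at (G : LCAGroup) (X : Type) (g : X -> G -> R) (l : list X) x :
  (forall i, continuous_at G (g i) x) -> continuous_at G (fun y => lsum (fun i => g i y) l) x.
Proof.
intros cg. induction l as [|i l IH]; intros eps e; simpl.
- exists (fun _ => True). repeat split; [apply gopen_full|].
  intros y _. rewrite Rminus_diag, Rabs_R0. lra.
- destruct (cg i (eps / 2)) as (U & oU & Ux & HU); [lra|].
  destruct (IH (eps / 2)) as (V & oV & Vx & HV); [lra|].
  exists (fun y => U y /\ V y). repeat split; trivial; [now apply gopen_inter|].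
  intros y [Uy Vy]. specialize (HU y Uy). specialize (HV y Vy). revert HU HV.
  unfold Rabs. repeat destruct (Rcase_abs _); lra.
Qed.

(** Near each point the convolution is a fixed finite sum of continuous functions. Under an almost
    period at most 2N terms change, each by at most M times the error. *)
Lemma strongly_ap_of_sup_ap (G : LCAGroup) (L : G -> Prop) (w : G -> R) :
  uniformly_discrete G L -> pos_measure_below_delta G L w -> sup_ap G w -> strongly_ap G w.
Proof.
intros ud (w0 & w1 & wL) sap f cf csf.
destruct (compact_support_bounded G f cf csf) as (M & M0 & HM).
destruct csf as (K & cK & supp).
assert (tK := compact_totally_bounded G K cK).
assert (nzL : forall x y, f (gsub x y) * w y <> 0 -> L y /\ K (gsub x y)).
{ intros x y nz. split; apply NNPP; intros n; apply nz.
  - rewrite (wL y n). ring.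
  - rewrite (supp _ n). ring. }
destruct (uniformly_discrete_count G L _ ud (totally_bounded_opp G K tK)) as [N HN].
assert (exF : forall x, exists s, HasSum (fun y => f (gsub x y) * w y) s).
{ intros x. destruct (HN x) as (l & _ & Hl).
  exists (lsum (fun y => f (gsub x y) * w y) (nodup classic_dec l)).
  apply HasSum_finite; [apply NoDup_nodup|]. intros y nz. apply nodup_In.
  destruct (nzL x y nz) as [Ly Ky]. apply Hl; trivial.
  now replace (gopp (gsub y x)) with (gsub x y) by abel. }
apply choice in exF. destruct exF as [F HF]. exists F. split; trivial. split.
- intros x0 eps e.
  destruct (compact_nbhd0 G) as (U & C & oU & U0 & UC & cC).
  destruct (uniformly_discrete_count G L _ ud
              (totally_bounded_sub G C K (compact_totally_bounded G C cC) tK)) as [N' HN'].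
  destruct (HN' x0) as (l' & _ & Hl'). set (l := nodup classic_dec l').
  (* One list serves all x in x0 + U, since a contributing y lies in L and in x0 + (C - K). *)
  assert (FE : forall x, U (gsub x x0) -> F x = lsum (fun y => f (gsub x y) * w y) l).
  { intros x Ux. apply (HasSum_unique _ _ _ (HF x)), HasSum_finite; [apply NoDup_nodup|].
    intros y nz. apply nodup_In. destruct (nzL x y nz) as [Ly Ky]. apply Hl'; trivial.
    exists (gsub x x0), (gsub x y). repeat split; auto. abel. }
  destruct (lsum_continuous_at G G (fun y x => f (gsub x y) * w y) l x0) with (eps := eps)
    as (V & oV & Vx & HV); trivial.
  { intros y d d0. destruct (cf (gsub x0 y) d d0) as (V & oV & Vx & HV).
    exists (fun x => V (gsub x y)). repeat split; trivial; [now apply gopen_translate|].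
    intros x Vxy. specialize (HV _ Vxy).
    replace (f (gsub x y) * w y - f (gsub x0 y) * w y)
      with ((f (gsub x y) - f (gsub x0 y)) * w y) by ring.
    assert (wy : 0 <= w y <= 1).
    { split; trivial. destruct (classic (L y)) as [Ly|nL]; auto. rewrite (wL y nL). lra. }
    rewrite Rabs_mult, (Rabs_pos_eq (w y)) by lra.
    generalize (Rabs_pos (f (gsub x y) - f (gsub x0 y))). nra. }
  exists (fun x => U (gsub x x0) /\ V x). repeat split; trivial.
  + apply gopen_inter; trivial. now apply gopen_translate.
  + now replace (gsub x0 x0) with (@gzero G) by abel.
  + intros x [Ux Vy]. rewrite (FE x Ux), (FE x0); auto.
    now replace (gsub x0 x0) with (@gzero G) by abel.
- intros eps e. assert (N0 := pos_INR N).
  assert (NM : 0 <= 2 * INR N * M) by (apply Rmult_le_pos; lra).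
  set (d := eps / (2 * INR N * M + 1)).
  assert (dE : d * (2 * INR N * M + 1) = eps) by (unfold d; field; lra).
  assert (d0 : 0 < d) by (apply Rdiv_lt_0_compat; lra).
  apply (relatively_dense_mono G _ _) with (2 := sap d d0).
  intros t (e' & le & Ht).
  assert (e'0 : 0 <= e') by (eapply Rle_trans; [apply Rabs_pos|apply (Ht gzero)]).
  exists (2 * INR N * (M * e')). split.
  { rewrite <- Rmult_assoc. apply Rmult_le_compat_l with (r1 := e') (r2 := d) in NM; lra. }
  intros x.
  (* Replacing y by y + t in the sum at x + t aligns it with the sum at x, and [f (gsub x y)]
     factors out of the difference. *)
  assert (S1 := HasSum_shift G _ _ t (HF (gadd x t))). cbv beta in S1.
  assert (S2 := HasSum_minus _ _ _ _ S1 (HF x)). cbv beta in S2.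
  destruct (HN x) as (l1 & len1 & H1). destruct (HN (gadd x t)) as (l2 & len2 & H2).
  apply Rle_trans with (INR (length (l1 ++ map (fun y => gsub y t) l2)) * (M * e')).
  + apply (HasSum_support_le _ _ _ _) with (2 := S2).
    * now apply Rmult_le_pos.
    * intros y. replace (gsub (gadd x t) (gadd y t)) with (gsub x y) by abel.
      replace (f (gsub x y) * w (gadd y t) - f (gsub x y) * w y)
        with (f (gsub x y) * (w (gadd t y) - w y)) by (rewrite (gaddC G t y); ring).
      rewrite Rabs_mult. apply Rmult_le_compat; auto using Rabs_pos.
    * intros y nz. apply in_or_app.
      destruct (Req_dec (f (gsub x y) * w y) 0) as [E|n1].
      -- assert (n2 : f (gsub (gadd x t) (gadd y t)) * w (gadd y t) <> 0) by lra.
         right. apply in_map_iff. exists (gadd y t). split; [abel|].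
         destruct (nzL _ _ n2) as [Ly Ky]. apply H2; trivial.
         now replace (gopp (gsub (gadd y t) (gadd x t)))
           with (gsub (gadd x t) (gadd y t)) by abel.
      -- left. destruct (nzL _ _ n1) as [Ly Ky]. apply H1; trivial.
         now replace (gopp (gsub y x)) with (gsub x y) by abel.
  + rewrite length_app, length_map, plus_INR.
    apply le_INR in len1, len2. apply Rmult_le_compat_r; [now apply Rmult_le_pos|lra].
Qed.

(* An almost period [t] of the smoothed measure need not be one of the measure;
   but every point [x] of large weight has a point [y] of the support with
   [x + t - y] small, and since [L - L] is uniformly discrete all the
   differences [y - x] coincide: this common value is the almost period. *)
Lemma sup_ap_of_strongly_ap (G : LCAGroup) (L : G -> Prop) (w : G -> R) :
  uniformly_discrete G (diffset G L) -> pos_measure_below_delta G L w ->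
  nonzero_measure G w -> strongly_ap G w -> sup_ap G w.
Proof.
intros (U & oU & U0 & HU) (w0 & w1 & wL) [x0 nz0] sap eps e.
destruct (compact_nbhd0 G) as (B & C & oB & B0 & BC & cC).
destruct (nbhd_sub G (fun x => U x /\ B x)) as (V & oV & V0 & sV & HV);
  [now apply gopen_inter|easy|].
assert (VC : forall x, V x -> C x).
{ intros x Vx. apply BC. replace x with (gsub x gzero) by abel. now apply HV. }
destruct (bump_exists G V oV V0) as (f & f01 & f0 & fV & fc).
destruct (sap f) as (F & HF & _ & ap).
{ intros x d d0. destruct (fc (d / 2)) as (V' & oV' & V'0 & HV'); [lra|].
  exists (fun y => V' (gsub y x)). repeat split.
  - now apply gopen_translate.
  - now replace (gsub x x) with (@gzero G) by abel.
  - intros y Vy. specialize (HV' _ x Vy). replace (gadd x (gsub y x)) with y in HV' by abel.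
    lra. }
{ exists C. split; trivial. intros x nC. apply NNPP. auto. }
assert (wL' : forall x, w x <> 0 -> L x) by (intros; apply NNPP; auto).
assert (nzV : forall x y, f (gsub x y) * w y <> 0 -> L y /\ V (gsub x y)).
{ intros x y nz. split; [apply wL'|apply fV]; intros E; apply nz; rewrite E; ring. }
assert (inL : forall x y, L x -> L y -> diffset G L (gsub x y)) by (intros x y; now exists x, y).
(* Two contributing points differ by an element of U, and both this difference and zero belong to L
   - L, so the points coincide. *)
assert (FE : forall x y, f (gsub x y) * w y <> 0 -> F x = f (gsub x y) * w y).
{ intros x y nz. destruct (nzV x y nz) as [Ly Vy].
  apply (HasSum_unique _ _ _ (HF x)).
  replace (f (gsub x y) * w y) with (lsum (fun y => f (gsub x y) * w y) [y])
    by (simpl; ring).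
  apply HasSum_finite; [constructor; [now intros []|constructor]|].
  intros z nz'. left. destruct (nzV x z nz') as [Lz Vz].
  apply gsub_eq0, HU; [now apply inL| |].
  - replace (@gzero G) with (gsub y y) by abel. now apply inL.
  - replace (gsub (gsub y z) gzero) with (gsub (gsub x z) (gsub x y)) by abel.
    now apply HV. }
assert (Fw : forall x, w x <> 0 -> F x = w x).
{ intros x nz. assert (E : f (gsub x x) = 1) by now replace (gsub x x) with (@gzero G) by abel.
  rewrite (FE x x); rewrite E, Rmult_1_l; trivial. }
assert (Fpos : forall x, 0 < F x -> exists y, L y /\ V (gsub x y) /\ F x <= w y).
{ intros x Fx. destruct (classic (exists y, f (gsub x y) * w y <> 0)) as [[y nz]|no].
  - exists y. destruct (nzV x y nz). repeat split; trivial. rewrite (FE x y nz).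
    generalize (f01 (gsub x y)) (w0 y). nra.
  - assert (Z : F x = lsum (fun y => f (gsub x y) * w y) []).
    { apply (HasSum_unique _ _ _ (HF x)), HasSum_finite; [constructor|].
      intros y nz. destruct no. now exists y. }
    simpl in Z. lra. }
assert (a0 : 0 < w x0) by (specialize (w0 x0); lra).
(* The bound by [w x0] keeps [x0] among the points of large weight, so that it supplies the
   reference difference [gsub y0 x0]. *)
set (d := Rmin eps (w x0)).
assert (d0 : 0 < d) by now apply Rmin_glb_lt.
assert (de : d <= eps) by apply Rmin_l. assert (da : d <= w x0) by apply Rmin_r.
destruct (ap d d0) as (K & cK & HK).
(* The true almost period found below differs from t by an element of V, hence of C, so K has to be
   enlarged by C. *)
apply (relatively_dense_tb G _ (fun z => exists a b, K a /\ C b /\ z = gsub a b)).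
{ apply totally_bounded_sub; now apply compact_totally_bounded. }
intros g. destruct (HK g) as (t & k & (e' & le & Ht) & Kk & ->).
assert (e'0 : 0 <= e') by (eapply Rle_trans; [apply Rabs_pos|apply (Ht gzero)]).
assert (P1 : forall x, e' < w x -> exists y, L y /\ V (gsub (gadd x t) y) /\ w x - e' <= w y).
{ intros x lx. assert (Fx : F x = w x) by (apply Fw; lra).
  assert (H := Ht x). apply Rabs_bounds in H.
  destruct (Fpos (gadd x t)) as (y & Ly & Vy & Fy); [lra|].
  exists y. repeat split; trivial. lra. }
assert (P2 : forall x, e' < w x -> exists y, L y /\ V (gsub (gsub x t) y) /\ w x - e' <= w y).
{ intros x lx. assert (Fx : F x = w x) by (apply Fw; lra).
  assert (H := Ht (gsub x t)). replace (gadd (gsub x t) t) with x in H by abel.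
  apply Rabs_bounds in H.
  destruct (Fpos (gsub x t)) as (y & Ly & Vy & Fy); [lra|].
  exists y. repeat split; trivial. lra. }
destruct (P1 x0) as (y0 & Ly0 & Vy0 & _); [lra|].
assert (Lx0 : L x0) by (apply wL'; lra).
(* A weight of at most [e'] makes the bound trivial. This is one half of the estimate; [A2], for the
   opposite shift, supplies the other. *)
assert (A1 : forall x, w x - e' <= w (gadd (gsub y0 x0) x)).
{ intros x. destruct (Rle_lt_dec (w x) e') as [s|s].
  - specialize (w0 (gadd (gsub y0 x0) x)). lra.
  - destruct (P1 x s) as (y & Ly & Vy & wy).
    assert (Lx : L x) by (apply wL'; lra).
    rewrite (HU (gsub y0 x0) (gsub y x)); auto.
    + now replace (gadd (gsub y x) x) with y by abel.
    + replace (gsub (gsub y0 x0) (gsub y x))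
        with (gsub (gsub (gadd x t) y) (gsub (gadd x0 t) y0)) by abel. now apply HV. }
assert (A2 : forall x, w x - e' <= w (gsub x (gsub y0 x0))).
{ intros x. destruct (Rle_lt_dec (w x) e') as [s|s].
  - specialize (w0 (gsub x (gsub y0 x0))). lra.
  - destruct (P2 x s) as (y & Ly & Vy & wy).
    assert (Lx : L x) by (apply wL'; lra).
    rewrite (HU (gsub y0 x0) (gsub x y)); auto.
    + now replace (gsub x (gsub x y)) with y by abel.
    + replace (gsub (gsub y0 x0) (gsub x y))
        with (gsub (gopp (gsub (gadd x0 t) y0)) (gsub (gsub x t) y)) by abel.
      apply HV; auto. }
exists (gsub y0 x0). split.
- exists e'. split; [lra|]. intros x. apply Rabs_le.
  specialize (A1 x). specialize (A2 (gadd (gsub y0 x0) x)).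
  replace (gsub (gadd (gsub y0 x0) x) (gsub y0 x0)) with x in A2 by abel. lra.
- exists k, (gopp (gsub (gadd x0 t) y0)). repeat split; auto. abel.
Qed.
(** * Model sets carry almost periodic measures *)

Section CutAndProject.
Variables (G H : LCAGroup) (Lt : (G * H)%type -> Prop).
Hypothesis Lt_add :
  forall p q, Lt p -> Lt q -> Lt (gadd (fst p) (fst q), gadd (snd p) (snd q)).
Hypothesis Lt_opp : forall p, Lt p -> Lt (gopp (fst p), gopp (snd p)).

Lemma lattice_sub x y h k : Lt (x, h) -> Lt (y, k) -> Lt (gsub x y, gsub h k).
Proof. intros Lx Ly. exact (Lt_add _ _ Lx (Lt_opp _ Ly)). Qed.

(** K times B is covered by finitely many small product boxes, and two lattice points in one box
    would differ by a lattice point in O. *)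
Lemma lattice_window_locally_finite (B : H -> Prop) :
  (exists O, prod_open G H O /\ O (gzero, gzero) /\
     forall p, Lt p -> O p -> p = (gzero, gzero)) ->
  totally_bounded H B -> locally_finite G (fun x => exists h, Lt (x, h) /\ B h).
Proof.
intros (O & oO & O0 & HO) tB K cK.
destruct (oO _ O0) as (U & V & oU & oV & U0 & V0 & UV). simpl in U0, V0.
destruct (nbhd_sub G U oU U0) as (U' & oU' & U'0 & _ & SU).
destruct (nbhd_sub H V oV V0) as (V' & oV' & V'0 & _ & SV).
destruct (compact_totally_bounded G K cK U' oU' U'0) as [cs Hcs].
destruct (tB V' oV' V'0) as [ds Hds].
destruct (finite_boxes (fun p => Lt p /\ K (fst p) /\ B (snd p))
            (fun c p => U' (gsub (fst p) (fst c)) /\ V' (gsub (snd p) (snd c)))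
            (list_prod cs ds)) as (l & _ & Hl).
- intros [x h] (_ & Kx & Bh). destruct (Hcs x Kx) as (c & ic & Uc).
  destruct (Hds h Bh) as (d & id & Vd). exists (c, d). split; [now apply in_prod|easy].
- intros [c d] [x h] [y k] (Lx & _) (Ly & _) [Ux Vh] [Uy Vk]. simpl in *.
  assert (E : (gsub x y, gsub h k) = (gzero, gzero)).
  { apply HO; [now apply lattice_sub|]. apply UV.
    - replace (gsub x y) with (gsub (gsub x c) (gsub y c)) by abel. auto.
    - replace (gsub h k) with (gsub (gsub h d) (gsub k d)) by abel. auto. }
  injection E as E1 E2. f_equal; now apply gsub_eq0.
- exists (map fst l). intros x (h & Lx & Bh) Kx. now apply (in_map fst l (x, h)), Hl.
Qed.

Lemma projection_totally_bounded (X : LCAGroup) (p : (G * H)%type -> X) C :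
  (forall U, gopen X U -> prod_open G H (fun q => U (p q))) ->
  is_compact (prod_open G H) C -> totally_bounded X (fun x => exists q, C q /\ x = p q).
Proof.
intros cp cC U oU U0.
destruct (cC (fun V => exists c, V = fun q => U (gsub (p q) c))) as (l & H1 & H2).
- intros V [c ->]. now apply (cp (fun x => U (gsub x c))), gopen_translate.
- intros q _. exists (fun r => U (gsub (p r) (p q))). split; [now exists (p q)|].
  now replace (gsub (p q) (p q)) with (@gzero X) by abel.
- destruct (list_choice _ l H1) as (m & H3 & _). exists m. intros x (q & Cq & ->).
  destruct (H2 q Cq) as (V & iV & Vq). destruct (H3 V iV) as (c & ic & ->). now exists c.
Qed.

(** Decompose (g, 0) as c + q. The second component of q is the negative of that of c, and c ranges
    over a compact set; so one of finitely many lattice points p, obtained by density, brings the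
    second component of q + p into V. What remains of g is the difference of the first components of
    c and p. *)
Lemma lattice_window_relatively_dense (V : H -> Prop) :
  (exists C, is_compact (prod_open G H) C /\
     forall p, exists c q, C c /\ Lt q /\
       p = (gadd (fst c) (fst q), gadd (snd c) (snd q))) ->
  (forall V, gopen H V -> (exists h, V h) -> exists p, Lt p /\ V (snd p)) ->
  gopen H V -> V gzero -> relatively_dense G (fun x => exists h, Lt (x, h) /\ V h).
Proof.
intros (C & cC & HC) dense oV V0.
destruct (nbhd_sub H V oV V0) as (V' & oV' & V'0 & _ & SV).
assert (t1 : totally_bounded G (fun x => exists q, C q /\ x = fst q)).
{ apply projection_totally_bounded; trivial. intros U oU q Uq.
  exists U, (fun _ => True). repeat split; trivial. apply gopen_full. }
assert (t2 : totally_bounded H (fun x => exists q, C q /\ x = snd q)).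
{ apply projection_totally_bounded; trivial. intros U oU q Uq.
  exists (fun _ => True), U. repeat split; trivial. apply gopen_full. }
destruct (t2 V' oV' V'0) as [l Hl].
destruct (list_choice (fun h p => Lt p /\ V' (gsub (snd p) h)) l) as (m & Hm & _).
{ intros h _. apply (dense (fun k => V' (gsub k h))).
  - now apply gopen_translate.
  - exists h. now replace (gsub h h) with (@gzero H) by abel. }
apply (relatively_dense_tb G _
  (fun x => exists a b, (exists q, C q /\ a = fst q) /\ In b (map fst m) /\ x = gsub a b)).
{ apply totally_bounded_sub; trivial. apply totally_bounded_list. }
intros g. destruct (HC (g, gzero)) as (c & q & Cc & Lq & E). injection E as E1 E2.
destruct (Hl (snd c)) as (h & ih & Vh); [now exists c|].
destruct (Hm h ih) as (p & ip & Lp & Vp).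
exists (gadd (fst q) (fst p)). split.
- exists (gadd (snd q) (snd p)). split; [now apply Lt_add|].
  replace (gadd (snd q) (snd p)) with (gsub (gsub (snd p) h) (gsub (snd c) h)); auto.
  replace (gsub (gsub (snd p) h) (gsub (snd c) h))
    with (gadd (gopp (snd c)) (gadd (snd p) gzero)) by abel.
  rewrite E2. abel.
- exists (fst c), (fst p). repeat split.
  + now exists c.
  + now apply in_map.
  + rewrite E1. abel.
Qed.
End CutAndProject.

Lemma model_set_flc (G : LCAGroup) (L : G -> Prop) :
  model_set G L -> finite_local_complexity G L /\ uniformly_discrete G (diffset G L).
Proof.
intros (H & Lt & W & _ & add & opp & disc & _ & _ & _ & cW & _ & LW).
assert (tW : totally_bounded H W).
{ apply (totally_bounded_mono H W (closure (gopen H) W)).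
  - intros h Wh U _ Uh. now exists h.
  - now apply compact_totally_bounded. }
(* Stated for general A and B because it is used twice: for L, and then for L - L with window W - W.
   Local finiteness of the second difference set makes L - L uniformly discrete. *)
assert (D : forall A B, totally_bounded H B ->
          (forall x, A x -> exists h, Lt (x, h) /\ B h) ->
          finite_local_complexity G A /\ totally_bounded H (diffset H B) /\
          forall x, diffset G A x -> exists h, Lt (x, h) /\ diffset H B h).
{ intros A B tB AB.
  assert (tD : totally_bounded H (diffset H B)) by now apply totally_bounded_sub.
  assert (win : forall x, diffset G A x -> exists h, Lt (x, h) /\ diffset H B h).
  { intros x (a & b & Aa & Ab & ->). destruct (AB a Aa) as (h & La & Bh).
    destruct (AB b Ab) as (k & Lb & Bk). exists (gsub h k).
    split; [now apply lattice_sub|now exists h, k]. }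
  repeat split; trivial. intros K cK.
  destruct (lattice_window_locally_finite G H Lt add opp (diffset H B) disc tD K cK)
    as [l Hl].
  exists l. auto. }
destruct (D L W tW) as (flc & tD & win); [intros x; apply LW|].
split; trivial. apply flc_uniformly_discrete. now destruct (D _ _ tD win).
Qed.

Lemma model_set_sup_ap (G : LCAGroup) (L : G -> Prop) :
  model_set G L ->
  exists w, pos_measure_below_delta G L w /\ nonzero_measure G w /\ sup_ap G w.
Proof.
intros (H & Lt & W & _ & add & opp & _ & coc & inj & dense & _ & (Q & oQ & [h0 Qh] & QW) & LW).
destruct (bump_exists H (fun v => Q (gadd v h0))) as (f & f01 & f0 & fQ & fc).
{ now apply gopen_translate. }
{ now rewrite gadd0. }
assert (exw : forall x, exists r, (forall h, Lt (x, h) -> r = f (gsub h h0)) /\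
                (~ (exists h, Lt (x, h)) -> r = 0)).
{ intros x. destruct (classic (exists h, Lt (x, h))) as [[h Lh]|no].
  - exists (f (gsub h h0)). split; [|intros n; now destruct n; exists h].
    intros k Lk. assert (E := inj _ _ Lh Lk eq_refl). now injection E as <-.
  - exists 0. split; trivial. intros h Lh. now destruct no; exists h. }
apply choice in exw. destruct exw as [w Hw].
assert (w01 : forall x, 0 <= w x <= 1).
{ intros x. destruct (Hw x) as [H1 H2].
  destruct (classic (exists h, Lt (x, h))) as [[h Lh]|no].
  - now rewrite (H1 h Lh).
  - rewrite (H2 no). lra. }
exists w. split; [|split].
- split; [intros; apply w01|]. split; [intros; apply w01|]. intros x nL. destruct (Hw x) as [H1 H2].
  destruct (classic (exists h, Lt (x, h))) as [[h Lh]|no]; auto.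
  rewrite (H1 h Lh). apply NNPP. intros nz. apply nL, LW. exists h. split; trivial.
  apply QW. replace h with (gadd (gsub h h0) h0) by abel. auto.
(* Density provides a lattice point whose second component is so close to [h0] that its weight is at
   least 1/2. *)
- destruct (fc (/ 2)) as (V & oV & V0 & HV); [lra|].
  destruct (dense (fun h => V (gsub h h0))) as ([x h] & Lx & Vh).
  + now apply gopen_translate.
  + exists h0. now replace (gsub h0 h0) with (@gzero H) by abel.
  + exists x. destruct (Hw x) as [H1 _]. rewrite (H1 h Lx). simpl in Vh.
    specialize (HV _ gzero Vh). rewrite gadd0, f0 in HV. apply Rabs_bounds in HV. lra.
- intros eps e. destruct (fc (eps / 2)) as (V & oV & V0 & HV); [lra|].
  apply (relatively_dense_mono G (fun x => exists h, Lt (x, h) /\ V h)).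
  2: now apply lattice_window_relatively_dense.
  intros t (k & Lk & Vk). exists (eps / 2). split; [lra|]. intros x.
  destruct (Hw x) as [H1 H2]. destruct (Hw (gadd t x)) as [H3 H4].
  destruct (classic (exists h, Lt (x, h))) as [[h Lh]|no].
  + rewrite (H1 h Lh), (H3 (gadd k h)) by exact (add _ _ Lk Lh).
    replace (gsub (gadd k h) h0) with (gadd (gsub h h0) k) by abel. auto.
  (* Since t lies in the projected lattice, which is a group, x and t + x are outside it together
     and both weights vanish. *)
  + rewrite (H2 no), H4, Rminus_diag, Rabs_R0; [lra|]. intros [h Lh]. apply no.
    exists (gsub h k). replace x with (gsub (gadd t x) t) by abel. now apply lattice_sub.
Qed.
(** * The hull of an almost periodic measure *)

(** Tube lemma: a finite cover of the fibre over x still covers the fibres over a neighbourhood of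
    x. *)
Lemma compact_prod (G H : LCAGroup) (K : G -> Prop) (B : H -> Prop) :
  is_compact (gopen G) K -> is_compact (gopen H) B ->
  is_compact (prod_open G H) (fun p => K (fst p) /\ B (snd p)).
Proof.
intros cK cB F oF cov.
set (fin := fun (U : G -> Prop) l => (forall O, In O l -> F O) /\
       forall x y, U x -> B y -> exists O, In O l /\ O (x, y)).
assert (tube : forall x, K x -> exists U, (gopen G U /\ exists l, fin U l) /\ U x).
{ intros x Kx.
  destruct (cB (fun V => gopen H V /\ exists U O, gopen G U /\ U x /\ F O /\
                 forall a b, U a -> V b -> O (a, b))) as (l & H1 & H2).
  - now intros V [].
  - intros y By. destruct (cov (x, y)) as (O & FO & Oxy); [easy|].
    destruct (oF O FO _ Oxy) as (U & V & oU & oV & Ux & Vy & UV).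
    exists V. split; trivial. split; trivial. now exists U, O.
  - assert (E : exists U m, gopen G U /\ U x /\ (forall O, In O m -> F O) /\
              forall a b V, In V l -> U a -> V b -> exists O, In O m /\ O (a, b)).
    { clear H2. induction l as [|V l IH].
      - exists (fun _ => True), []. repeat split; [apply gopen_full|now intros ? []|].
        now intros ? ? ? [].
      - destruct IH as (U & m & oU & Ux & Fm & HU); [intros; apply H1; now right|].
        destruct (H1 V (or_introl eq_refl)) as (_ & U' & O & oU' & U'x & FO & HO).
        exists (fun a => U a /\ U' a), (O :: m). repeat split; trivial.
        + now apply gopen_inter.
        + intros O' [<-|i]; auto.
        + intros a b V' [<-|i] [Ua U'a] Vb; [exists O; simpl; auto|].
          destruct (HU a b V' i Ua Vb) as (O' & ? & ?). exists O'. simpl. auto. }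
    destruct E as (U & m & oU & Ux & Fm & HU). exists U. split; trivial. split; trivial.
    exists m. split; trivial. intros a b Ua Bb. destruct (H2 b Bb) as (V & iV & Vb). eauto. }
destruct (cK (fun U => gopen G U /\ exists l, fin U l)) as (l & H1 & H2); trivial.
{ now intros U []. }
destruct (list_choice fin l) as (m & H3 & H4).
{ intros U iU. now destruct (H1 U iU). }
exists (concat m). split.
- intros O iO. apply in_concat in iO. destruct iO as (l' & il' & iO).
  destruct (H4 l' il') as (U & _ & Fl & _). auto.
- intros [x y] [Kx By]. destruct (H2 x Kx) as (U & iU & Ux).
  destruct (H3 U iU) as (l' & il' & _ & cl'). destruct (cl' x y Ux By) as (O & iO & Oxy).
  exists O. split; trivial. apply in_concat. now exists l'.
Qed.

(** A closed bound with explicit error in place of a supremum: errors add up along chains, and the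
    bound survives limits. *)
Definition uclose {X : Type} (u v : X -> R) (e : R) : Prop :=
  forall x, Rabs (u x - v x) <= e.

Lemma uclose_sym {X} (u v : X -> R) e : uclose u v e -> uclose v u e.
Proof. intros H x. rewrite Rabs_minus_sym. auto. Qed.

Lemma uclose_trans {X} (u v z : X -> R) d e :
  uclose u v d -> uclose v z e -> uclose u z (d + e).
Proof.
intros H1 H2 x. replace (u x - z x) with ((u x - v x) + (v x - z x)) by ring.
eapply Rle_trans; [apply Rabs_triang|]. now apply Rplus_le_compat.
Qed.

Lemma uclose_le {X} (u v : X -> R) d e : d <= e -> uclose u v d -> uclose u v e.
Proof. intros le H x. eapply Rle_trans; eauto. Qed.

Lemma uclose_refl {X} (u : X -> R) e : 0 <= e -> uclose u u e.
Proof. intros e0 x. now rewrite Rminus_diag, Rabs_R0. Qed.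

Lemma uclose_eps {X} (u v : X -> R) e :
  (forall d, 0 < d -> uclose u v (e + d)) -> uclose u v e.
Proof. intros H x. apply le_epsilon. intros d d0. now apply H. Qed.

Section Hull.
Variables (G : LCAGroup) (w : G -> R).

(** In the usual convention this is the translate by -t. With this sign the value at [gzero] is
    [w t], so evaluation at zero extends w to the hull. *)
Definition translate (t x : G) : R := w (gadd x t).

Lemma translate_close_shift s t r e :
  uclose (translate s) (translate t) e ->
  uclose (translate (gadd s r)) (translate (gadd t r)) e.
Proof.
intros H x. specialize (H (gadd x r)). unfold translate in *.
replace (gadd x (gadd s r)) with (gadd (gadd x r) s) by abel.
now replace (gadd x (gadd t r)) with (gadd (gadd x r) t) by abel.
Qed.

Lemma translate_close_add s s' t t' d e :
  uclose (translate s) (translate s') d -> uclose (translate t) (translate t') e ->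
  uclose (translate (gadd s t)) (translate (gadd s' t')) (d + e).
Proof.
intros H1 H2. apply uclose_trans with (translate (gadd s' t)).
- now apply translate_close_shift.
- rewrite !(gaddC G s'). now apply translate_close_shift.
Qed.

(** Shifting by -(s + t) carries s and t to -t and -s. *)
Lemma translate_close_opp s t e :
  uclose (translate s) (translate t) e ->
  uclose (translate (gopp s)) (translate (gopp t)) e.
Proof.
intros H. apply uclose_sym.
replace (gopp t) with (gadd s (gopp (gadd s t))) by abel.
replace (gopp s) with (gadd t (gopp (gadd s t))) by abel.
now apply translate_close_shift.
Qed.

Definition in_hull (u : G -> R) : Prop :=
  forall e, 0 < e -> exists t, uclose u (translate t) e.

Definition hull : Type := {u : G -> R | in_hull u}.
Definition hfun (u : hull) : G -> R := proj1_sig u.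
Local Coercion hfun : hull >-> Funclass.

Lemma hull_approx (u : hull) e : 0 < e -> exists t, uclose u (translate t) e.
Proof. apply (proj2_sig u). Qed.

Lemma hull_eq (u v : hull) : (forall e, 0 < e -> uclose u v e) -> u = v.
Proof.
intros H. destruct u as [u hu], v as [v hv].
assert (E : u = v).
{ extensionality x. apply cond_eq. intros e e0.
  apply Rle_lt_trans with (e / 2); [|lra]. apply (H (e / 2)); lra. }
subst v. f_equal. apply proof_irrelevance.
Qed.

Lemma translate_in_hull t : in_hull (translate t).
Proof. intros e e0. exists t. apply uclose_refl. lra. Qed.

Definition hull_of (t : G) : hull := exist _ (translate t) (translate_in_hull t).

Lemma hull_complete {I : Type} (t : I -> G) (r : I -> R) :
  (forall e, 0 < e -> exists i, r i <= e) ->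
  (forall i j, uclose (translate (t i)) (translate (t j)) (r i + r j)) ->
  exists z : hull, forall i, uclose z (translate (t i)) (r i).
Proof.
intros r0 H. destruct (r0 1) as [i0 _]; [lra|].
destruct (choice (fun x z => forall i, Rabs (z - translate (t i) x) <= r i)) as [z Hz].
{ intros x. apply (intervals_common_point i0). intros i j. apply H. }
assert (hz : in_hull z).
{ intros e e0. destruct (r0 e e0) as [i Hi]. exists (t i). intros x.
  eapply Rle_trans; [apply Hz|trivial]. }
exists (exist _ z hz). intros i x. apply Hz.
Qed.

(** The index set consists of all pairs of approximations of u and v. No sequence is chosen, and the
    limit respects every approximation at once. *)
Lemma hull_add_exists (u v : hull) :
  exists z : hull, forall s t d e,
    uclose u (translate s) d -> uclose v (translate t) e ->
    uclose z (translate (gadd s t)) (d + e).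
Proof.
set (I := {p : (G * R) * (G * R) |
            uclose u (translate (fst (fst p))) (snd (fst p)) /\
            uclose v (translate (fst (snd p))) (snd (snd p))}).
destruct (hull_complete (I := I)
  (fun i => gadd (fst (fst (proj1_sig i))) (fst (snd (proj1_sig i))))
  (fun i => snd (fst (proj1_sig i)) + snd (snd (proj1_sig i)))) as [z Hz].
- intros e e0. destruct (hull_approx u (e / 2)) as [s Hs]; [lra|].
  destruct (hull_approx v (e / 2)) as [t Ht]; [lra|].
  exists (exist _ ((s, e / 2), (t, e / 2)) (conj Hs Ht)). simpl. lra.
- intros [[[s d] [t e]] [H1 H2]] [[[s' d'] [t' e']] [H1' H2']]. simpl in *.
  replace (d + e + (d' + e')) with ((d + d') + (e + e')) by ring.
  apply translate_close_add.
  + apply uclose_trans with u; trivial. now apply uclose_sym.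
  + apply uclose_trans with v; trivial. now apply uclose_sym.
- exists z. intros s t d e H1 H2.
  exact (Hz (exist _ ((s, d), (t, e)) (conj H1 H2))).
Qed.

Lemma hull_opp_exists (u : hull) :
  exists z : hull, forall s d,
    uclose u (translate s) d -> uclose z (translate (gopp s)) d.
Proof.
set (I := {p : G * R | uclose u (translate (fst p)) (snd p)}).
destruct (hull_complete (I := I)
  (fun i => gopp (fst (proj1_sig i))) (fun i => snd (proj1_sig i))) as [z Hz].
- intros e e0. destruct (hull_approx u e e0) as [s Hs].
  exists (exist _ (s, e) Hs). simpl. lra.
- intros [[s d] H1] [[s' d'] H1']. simpl in *. apply translate_close_opp.
  apply uclose_trans with u; trivial. now apply uclose_sym.
- exists z. intros s d H1. exact (Hz (exist _ (s, d) H1)).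
Qed.

Definition hull_add (u v : hull) : hull :=
  proj1_sig (constructive_indefinite_description _ (hull_add_exists u v)).
Definition hull_opp (u : hull) : hull :=
  proj1_sig (constructive_indefinite_description _ (hull_opp_exists u)).

Lemma hull_add_close (u v : hull) s t d e :
  uclose u (translate s) d -> uclose v (translate t) e ->
  uclose (hull_add u v) (translate (gadd s t)) (d + e).
Proof.
unfold hull_add. destruct constructive_indefinite_description as [z Hz]. apply Hz.
Qed.

Lemma hull_opp_close (u : hull) s d :
  uclose u (translate s) d -> uclose (hull_opp u) (translate (gopp s)) d.
Proof.
unfold hull_opp. destruct constructive_indefinite_description as [z Hz]. apply Hz.
Qed.

Lemma hull_of_close t e : 0 <= e -> uclose (hull_of t) (translate t) e.
Proof. intros e0. now apply uclose_refl. Qed.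

(** Reduces each group law of the hull to the same law in G, applied to a common approximating
    translate. *)
Lemma hull_eq_approx (u v : hull) :
  (forall e, 0 < e -> exists t, uclose u (translate t) e /\ uclose v (translate t) e) ->
  u = v.
Proof.
intros H. apply hull_eq. intros e e0. destruct (H (e / 2)) as (t & Hu & Hv); [lra|].
replace e with (e / 2 + e / 2) by field. apply uclose_trans with (translate t); trivial.
now apply uclose_sym.
Qed.

Lemma hull_addA u v z : hull_add u (hull_add v z) = hull_add (hull_add u v) z.
Proof.
apply hull_eq_approx. intros e e0.
destruct (hull_approx u (e / 3)) as [r Hr]; [lra|].
destruct (hull_approx v (e / 3)) as [s Hs]; [lra|].
destruct (hull_approx z (e / 3)) as [t Ht]; [lra|].
exists (gadd r (gadd s t)). split.
- replace e with (e / 3 + (e / 3 + e / 3)) by field. auto using hull_add_close.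
- replace e with (e / 3 + e / 3 + e / 3) by field. rewrite gaddA.
  auto using hull_add_close.
Qed.

Lemma hull_addC u v : hull_add u v = hull_add v u.
Proof.
apply hull_eq_approx. intros e e0.
destruct (hull_approx u (e / 2)) as [s Hs]; [lra|].
destruct (hull_approx v (e / 2)) as [t Ht]; [lra|].
replace e with (e / 2 + e / 2) by field.
exists (gadd s t). split; [|rewrite gaddC]; auto using hull_add_close.
Qed.

Lemma hull_add0 u : hull_add (hull_of gzero) u = u.
Proof.
apply hull_eq_approx. intros e e0. destruct (hull_approx u e e0) as [t Ht].
exists t. split; trivial. rewrite <- (gadd0 G t), <- (Rplus_0_l e).
apply hull_add_close; trivial. apply hull_of_close. lra.
Qed.

Lemma hull_addN u : hull_add (hull_opp u) u = hull_of gzero.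
Proof.
apply hull_eq_approx. intros e e0. destruct (hull_approx u (e / 2)) as [t Ht]; [lra|].
exists gzero. split; [|apply hull_of_close; lra].
replace e with (e / 2 + e / 2) by field. rewrite <- (gaddN G t).
auto using hull_add_close, hull_opp_close.
Qed.

Lemma hull_of_add s t : hull_add (hull_of s) (hull_of t) = hull_of (gadd s t).
Proof.
apply hull_eq_approx. intros e e0. exists (gadd s t). split; [|apply hull_of_close; lra].
replace e with (e / 2 + e / 2) by field. apply hull_add_close; apply hull_of_close; lra.
Qed.

Lemma hull_of_opp t : hull_opp (hull_of t) = hull_of (gopp t).
Proof.
apply hull_eq_approx. intros e e0. exists (gopp t). split; [|apply hull_of_close; lra].
apply hull_opp_close, hull_of_close. lra.
Qed.

Lemma hull_add_lipschitz (u u' v v' : hull) d e :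
  uclose u u' d -> uclose v v' e -> uclose (hull_add u v) (hull_add u' v') (d + e).
Proof.
intros Hu Hv. apply uclose_eps. intros h h0.
destruct (hull_approx u (h / 4)) as [s Hs]; [lra|].
destruct (hull_approx v (h / 4)) as [t Ht]; [lra|].
replace (d + e + h) with ((h / 4 + h / 4) + ((d + h / 4) + (e + h / 4))) by field.
apply uclose_trans with (translate (gadd s t)); [now apply hull_add_close|].
apply uclose_sym, hull_add_close.
- apply uclose_trans with u; trivial. now apply uclose_sym.
- apply uclose_trans with v; trivial. now apply uclose_sym.
Qed.

Lemma hull_opp_lipschitz (u v : hull) e :
  uclose u v e -> uclose (hull_opp u) (hull_opp v) e.
Proof.
intros H. apply uclose_eps. intros h h0.
destruct (hull_approx u (h / 2)) as [s Hs]; [lra|].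
replace (e + h) with (h / 2 + (e + h / 2)) by field.
apply uclose_trans with (translate (gopp s)); [now apply hull_opp_close|].
apply uclose_sym, hull_opp_close. apply uclose_trans with u; trivial. now apply uclose_sym.
Qed.

(** * Sup-norm topology and compactness in the hull *)

Definition hull_open (U : hull -> Prop) : Prop :=
  forall u, U u -> exists e, 0 < e /\ forall v : hull, uclose u v e -> U v.

Definition hull_ball (u : hull) (e : R) (v : hull) : Prop :=
  exists r, r < e /\ uclose u v r.

Lemma hull_ball_open u e : hull_open (hull_ball u e).
Proof.
intros v (r & lt & H). exists ((e - r) / 2). split; [lra|]. intros v' H'.
exists (r + (e - r) / 2). split; [lra|]. now apply uclose_trans with v.
Qed.

Lemma hull_ball_center u e : 0 < e -> hull_ball u e u.
Proof. intros e0. exists 0. split; trivial. apply uclose_refl. lra. Qed.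

Lemma hull_open_full : hull_open (fun _ => True).
Proof. intros u _. exists 1. split; [lra|easy]. Qed.

Lemma hull_open_inter U V : hull_open U -> hull_open V -> hull_open (fun x => U x /\ V x).
Proof.
intros oU oV u [Uu Vu]. destruct (oU u Uu) as (d & d0 & Hd).
destruct (oV u Vu) as (e & e0 & He). exists (Rmin d e).
split; [now apply Rmin_glb_lt|]. intros v H. split.
- apply Hd. apply (uclose_le _ _ (Rmin d e)); trivial. apply Rmin_l.
- apply He. apply (uclose_le _ _ (Rmin d e)); trivial. apply Rmin_r.
Qed.

Lemma hull_open_union (F : (hull -> Prop) -> Prop) :
  (forall U, F U -> hull_open U) -> hull_open (fun x => exists U, F U /\ U x).
Proof.
intros oF u (U & FU & Uu). destruct (oF U FU u Uu) as (e & e0 & He).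
exists e. split; trivial. intros v H. exists U. auto.
Qed.

Lemma hull_add_cont u v U : hull_open U -> U (hull_add u v) ->
  exists V W, hull_open V /\ hull_open W /\ V u /\ W v /\
    forall a b, V a -> W b -> U (hull_add a b).
Proof.
intros oU Uuv. destruct (oU _ Uuv) as (e & e0 & He).
exists (hull_ball u (e / 2)), (hull_ball v (e / 2)).
repeat split; try apply hull_ball_open; try (apply hull_ball_center; lra).
intros a b (r & lr & Hr) (s & ls & Hs). apply He.
apply (uclose_le _ _ (r + s)); [lra|]. now apply hull_add_lipschitz.
Qed.

Lemma hull_opp_cont u U : hull_open U -> U (hull_opp u) ->
  exists V, hull_open V /\ V u /\ forall a, V a -> U (hull_opp a).
Proof.
intros oU Uu. destruct (oU _ Uu) as (e & e0 & He). exists (hull_ball u e).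
repeat split; try apply hull_ball_open; try (now apply hull_ball_center).
intros a (r & lr & Hr). apply He. apply (uclose_le _ _ r); [lra|].
now apply hull_opp_lipschitz.
Qed.

Lemma hull_hausdorff (u v : hull) : u <> v ->
  exists U V, hull_open U /\ hull_open V /\ U u /\ V v /\ forall z, U z -> V z -> False.
Proof.
intros ne. destruct (classic (exists x, u x <> v x)) as [[x nx]|no].
- assert (p : 0 < Rabs (u x - v x)) by (apply Rabs_pos_lt; lra).
  exists (hull_ball u (Rabs (u x - v x) / 2)), (hull_ball v (Rabs (u x - v x) / 2)).
  repeat split; try apply hull_ball_open; try (apply hull_ball_center; lra).
  intros z (r & lr & Hr) (s & ls & Hs). apply uclose_sym in Hs.
  generalize (uclose_trans _ _ _ _ _ Hr Hs x). lra.
- destruct ne. apply hull_eq. intros e e0 x.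
  assert (E : u x = v x) by (apply NNPP; intros n; apply no; now exists x).
  rewrite E, Rminus_diag, Rabs_R0. lra.
Qed.

(** Without a finite subcover, some piece of size [(/ 2) ^ n] has none either. The nested pieces
    close in on a point z of A, and a single member of F around z covers a late piece. *)
Lemma hull_compact (A : hull -> Prop) :
  (forall u : hull, (forall e, 0 < e -> exists v : hull, A v /\ uclose u v e) -> A u) ->
  (forall e, 0 < e -> exists l : list G,
     forall u : hull, A u -> exists k, In k l /\ uclose u (translate k) e) ->
  is_compact hull_open A.
Proof.
intros closed tb F oF cov. apply NNPP. intros nofin.
set (fin := fun S : hull -> Prop => exists l,
       (forall U, In U l -> F U) /\ (forall x, S x -> exists U, In U l /\ U x)).
change (~ fin A) in nofin.
(* The premises stand inside the existential so that [choice] yields a total function; where they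
   fail, any k will do. *)
assert (step : forall p : nat * (hull -> Prop), exists k, ~ fin (snd p) ->
   (forall x, snd p x -> A x) ->
   ~ fin (fun x => snd p x /\ uclose x (translate k) ((/ 2) ^ fst p))).
{ intros [n S]. simpl. apply NNPP. intros no.
  assert (H : ~ fin S /\ forall x, S x -> A x).
  { split; [intros f|apply NNPP; intros f]; apply no; exists gzero; tauto. }
  destruct H as [nS SA]. apply nS. destruct (tb _ (pow_half_pos n)) as [l Hl].
  assert (P : forall k, fin (fun x => S x /\ uclose x (translate k) ((/ 2) ^ n))).
  { intros k. apply NNPP. intros nk. apply no. exists k. auto. }
  destruct (list_choice (fun k m => (forall U, In U m -> F U) /\
    forall x, S x /\ uclose x (translate k) ((/ 2) ^ n) -> exists U, In U m /\ U x) l)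
    as (m & H3 & H4).
  { intros k _. apply P. }
  exists (concat m). split.
  - intros U i. apply in_concat in i. destruct i as (l' & il' & i).
    destruct (H4 l' il') as (k & _ & Fl & _). auto.
  - intros x Sx. destruct (Hl x (SA x Sx)) as (k & ik & Hk).
    destruct (H3 k ik) as (l' & il' & _ & c). destruct (c x (conj Sx Hk)) as (U & iU & Ux).
    exists U. split; trivial. apply in_concat. now exists l'. }
apply choice in step. destruct step as [k Hk].
(* This local name hides the successor, hence [Datatypes.S] from here on. *)
set (S := fix S n := match n with
  | O => A
  | Datatypes.S n' => fun x => S n' x /\ uclose x (translate (k (n', S n'))) ((/ 2) ^ n')
  end).
assert (SH : forall n, ~ fin (S n) /\ forall x, S n x -> A x).
{ induction n as [|n [IH1 IH2]]; [easy|]. split; [exact (Hk (n, S n) IH1 IH2)|].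
  intros x [Sx _]. auto. }
assert (Smono : forall i j x, (i <= j)%nat -> S j x -> S i x).
{ intros i j x le. induction le as [|j _ IH]; trivial. intros [Sx _]. auto. }
assert (Sne : forall n, exists x, S n x).
{ intros n. apply NNPP. intros no. apply (SH n). exists []. split; [now intros ? []|].
  intros x Sx. now destruct no; exists x. }
set (t := fun n => k (n, S n)).
assert (Sball : forall i j x, (i < j)%nat -> S j x -> uclose x (translate (t i)) ((/ 2) ^ i)).
{ intros i j x lt Sx. now destruct (Smono (Datatypes.S i) j x lt Sx) as [_ H]. }
destruct (hull_complete t (fun n => (/ 2) ^ n)) as [z Hz].
{ intros e e0. destruct (pow_half_small e e0) as [n Hn]. exists n. lra. }
{ intros i j. destruct (Sne (Datatypes.S (i + j))) as [x Sx].
  apply uclose_trans with x; [apply uclose_sym|];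
    apply (Sball _ (Datatypes.S (i + j))); trivial; lia. }
assert (Sz : forall n x, S (Datatypes.S n) x -> uclose z x (2 * (/ 2) ^ n)).
{ intros n x [_ H]. replace (2 * (/ 2) ^ n) with ((/ 2) ^ n + (/ 2) ^ n) by ring.
  apply uclose_trans with (translate (t n)); [apply Hz|now apply uclose_sym]. }
assert (Az : A z).
{ apply closed. intros e e0. destruct (pow_half_small (e / 2)) as [n Hn]; [lra|].
  destruct (Sne (Datatypes.S n)) as [x Sx]. exists x. split; [now apply (SH (Datatypes.S n))|].
  apply (uclose_le _ _ (2 * (/ 2) ^ n)); [lra|auto]. }
destruct (cov z Az) as (U & FU & Uz). destruct (oF U FU z Uz) as (e & e0 & He).
destruct (pow_half_small (e / 2)) as [n Hn]; [lra|].
apply (SH (Datatypes.S n)). exists [U]. split.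
- now intros V [<-|[]].
- intros x Sx. exists U. split; [now left|]. apply He.
  apply (uclose_le _ _ (2 * (/ 2) ^ n)); [lra|auto].
Qed.

(** * The cut and project scheme of a sup-almost periodic measure *)

Variables (L : G -> Prop) (x0 : G).
Hypothesis flc : finite_local_complexity G L.
Hypothesis w_support : forall x, ~ L x -> w x = 0.
Hypothesis w_pos : 0 < w x0.
Hypothesis w_sup_ap : sup_ap G w.

Lemma support_in x : 0 < w x -> L x.
Proof. intros p. apply NNPP. intros nL. rewrite (w_support x nL) in p. lra. Qed.

Lemma almost_periods e : 0 < e ->
  exists K, is_compact (gopen G) K /\
    forall g, exists s k, K k /\ g = gadd s k /\
      uclose (translate s) (translate gzero) e.
Proof.
intros e0. destruct (w_sup_ap e e0) as (K & cK & HK). exists K. split; trivial.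
intros g. destruct (HK g) as (s & k & (e' & le & Hs) & Kk & E).
exists s, k. repeat split; trivial. intros x. unfold translate.
replace (gadd x s) with (gadd s x) by abel. replace (gadd x gzero) with x by abel.
specialize (Hs x). lra.
Qed.

Lemma almost_period_support t e :
  e < w x0 -> uclose (translate t) (translate gzero) e -> L (gadd x0 t).
Proof.
intros le H. specialize (H x0). unfold translate in H.
replace (gadd x0 gzero) with x0 in H by abel.
apply Rabs_bounds in H. apply support_in. lra.
Qed.

Lemma almost_period_diffset t e :
  e < w x0 -> uclose (translate t) (translate gzero) e -> diffset G L t.
Proof.
intros le H. exists (gadd x0 t), x0. repeat split.
- now apply almost_period_support with e.
- now apply support_in.
- abel.
Qed.

(** Approximate u by the translate at t' and split t' - t into an almost period and some k in K.
    Dropping the almost period costs little, and k is then itself an almost period of error below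
    [w x0], so it lies in the finite part of L - L inside K. *)
Lemma hull_ball_totally_bounded t r e :
  r < w x0 -> 0 < e ->
  exists l : list G, forall u : hull, uclose u (translate t) r ->
    exists k, In k l /\ uclose u (translate k) e.
Proof.
intros lr e0. set (d := Rmin (e / 2) ((w x0 - r) / 3)).
assert (d0 : 0 < d) by (apply Rmin_glb_lt; lra).
assert (d1 : d <= e / 2) by apply Rmin_l.
assert (d2 : d <= (w x0 - r) / 3) by apply Rmin_r.
destruct (almost_periods d d0) as (K & cK & HK). destruct (flc K cK) as [l Hl].
exists (map (gadd t) l). intros u Hu. destruct (hull_approx u d d0) as [t' Ht'].
destruct (HK (gsub t' t)) as (s & k & Kk & E & Hs).
assert (A : uclose (translate t') (translate (gadd t k)) d).
{ replace t' with (gadd s (gadd t k)).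
  - rewrite <- (gadd0 G (gadd t k)) at 2. now apply translate_close_shift.
  - replace (gadd s (gadd t k)) with (gadd t (gadd s k)) by abel. rewrite <- E. abel. }
assert (B : uclose u (translate (gadd t k)) (d + d)) by now apply uclose_trans with (translate t').
exists (gadd t k). split; [apply in_map|apply (uclose_le _ _ (d + d)); trivial; lra].
apply Hl; trivial. apply almost_period_diffset with (d + d + r); [lra|].
apply uclose_sym in B. assert (C := uclose_trans _ _ _ _ _ B Hu).
apply translate_close_shift with (r := gopp t) in C.
replace (gadd (gadd t k) (gopp t)) with k in C by abel.
now replace (gadd t (gopp t)) with (@gzero G) in C by abel.
Qed.

Lemma hull_closed_ball_compact (u : hull) r :
  r < w x0 -> is_compact hull_open (fun v : hull => uclose u v r).
Proof.
intros lr. apply hull_compact.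
- intros v H. apply uclose_eps. intros d d0. destruct (H d d0) as (v' & H1 & H2).
  apply uclose_trans with v'; trivial. now apply uclose_sym.
- intros e e0. set (d := (w x0 - r) / 2). destruct (hull_approx u d) as [t Ht].
  { unfold d. lra. }
  destruct (hull_ball_totally_bounded t (r + d) e) as [l Hl]; trivial; [unfold d; lra|].
  exists l. intros v Hv. apply Hl. apply uclose_trans with u; trivial. now apply uclose_sym.
Qed.

Lemma hull_locally_compact (u : hull) :
  exists U K, hull_open U /\ U u /\ (forall z, U z -> K z) /\ is_compact hull_open K.
Proof.
exists (hull_ball u (w x0 / 2)), (fun v : hull => uclose u v (w x0 / 2)). repeat split.
- apply hull_ball_open.
- apply hull_ball_center. lra.
- intros v (r & lr & H). apply (uclose_le _ _ r); trivial. lra.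
- apply hull_closed_ball_compact. lra.
Qed.

Definition hull_group : LCAGroup :=
  mkLCA hull (hull_of gzero) hull_add hull_opp hull_addA hull_addC hull_add0 hull_addN
    hull_open hull_open_full hull_open_inter hull_open_union hull_add_cont hull_opp_cont
    hull_hausdorff hull_locally_compact.

Definition hull_lattice (p : (G * hull_group)%type) : Prop := snd p = hull_of (fst p).

(* [u gzero] is the value at [u] of the continuous extension of the weights to
   the hull; adding its support makes the window fat without adding points. *)
Definition hull_window (u : hull_group) : Prop :=
  (exists x, L x /\ u = hull_of x) \/ 0 < hfun u gzero.

Lemma hull_lattice_discrete :
  exists O, prod_open G hull_group O /\ O (gzero, gzero) /\
    forall p, hull_lattice p -> O p -> p = (gzero, gzero).
Proof.
destruct (locally_finite_isolated0 G _ flc) as (U & oU & U0 & HU).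
exists (fun p => U (fst p) /\ hull_ball (hull_of gzero) (w x0) (snd p)). split; [|split].
- intros p [Up Bp]. exists U, (hull_ball (hull_of gzero) (w x0)).
  repeat split; trivial. apply hull_ball_open.
- split; trivial. now apply hull_ball_center.
- intros [x h] E [Ux (r & lr & Hr)]. unfold hull_lattice in E. simpl in E, Ux, Hr. subst h.
  assert (Ex : x = gzero); [|now subst x].
  apply HU; trivial. apply almost_period_diffset with r; trivial. now apply uclose_sym.
Qed.

(** For (g, h) pick t with its translate near h, then an almost period s with g - t - s in K.
    Subtracting the lattice point over t + s leaves a second component near the translate at -s,
    hence near zero. Two errors of [w x0 / 4] stay within a compact ball. *)
Lemma hull_lattice_cocompact :
  exists C, is_compact (prod_open G hull_group) C /\
    forall p, exists c q, C c /\ hull_lattice q /\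
      p = (gadd (fst c) (fst q), gadd (snd c) (snd q)).
Proof.
destruct (almost_periods (w x0 / 4)) as (K & cK & HK); [lra|].
set (B := fun u : hull => uclose (hull_of gzero) u (w x0 / 2)).
exists (fun p : (G * hull_group)%type => K (fst p) /\ B (snd p)). split.
- apply (compact_prod G hull_group K B); trivial. apply hull_closed_ball_compact. lra.
- intros [g h]. destruct (hull_approx h (w x0 / 4)) as [t Ht]; [lra|].
  destruct (HK (gsub g t)) as (s & k & Kk & E & Hs).
  exists (k, gsub h (hull_of (gadd t s) : hull_group)), (gadd t s, hull_of (gadd t s)).
  repeat split; simpl; trivial.
  + apply uclose_sym.
    assert (A : uclose (hull_add h (hull_opp (hull_of (gadd t s))))
                  (translate (gadd t (gopp (gadd t s)))) (w x0 / 4 + 0)).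
    { apply hull_add_close; trivial. apply hull_opp_close, hull_of_close. lra. }
    replace (gadd t (gopp (gadd t s))) with (gopp s) in A by abel.
    apply translate_close_opp in Hs. replace (gopp gzero) with (@gzero G) in Hs by abel.
    replace (w x0 / 2) with (w x0 / 4 + 0 + w x0 / 4) by field.
    now apply uclose_trans with (translate (gopp s)).
  + f_equal.
    * replace (gadd k (gadd t s)) with (gadd t (gadd s k)) by abel. rewrite <- E. abel.
    (* Shows the operations as those of [hull_group], so that [abel] works in the hull. *)
    * change (h = @gadd hull_group (gsub h (hull_of (gadd t s) : hull_group))
                    (hull_of (gadd t s))).
      abel.
Qed.

Lemma hull_window_approx (u : hull) e :
  hull_window u -> 0 < e -> exists x, L x /\ uclose u (translate x) e.
Proof.
intros [(x & Lx & ->)|p] e0.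
- exists x. split; trivial. apply hull_of_close. lra.
(* An error of at most half of [u gzero] leaves [w t] positive, which puts t in L. *)
- destruct (hull_approx u (Rmin e (hfun u gzero / 2))) as [t Ht].
  { apply Rmin_glb_lt; lra. }
  exists t. split; [|apply (uclose_le _ _ _ e) in Ht; trivial; apply Rmin_l].
  specialize (Ht gzero). unfold translate in Ht. rewrite gadd0 in Ht.
  apply Rabs_bounds in Ht. generalize (Rmin_r e (hfun u gzero / 2)). intros.
  apply support_in. lra.
Qed.

(** Write x in L as s + (x0 + k) with s an almost period and k in K. Then x0 + s is in L, so k = x -
    (x0 + s) lies in L - L, and only finitely many k occur. *)
Lemma hull_window_precompact :
  is_compact (gopen hull_group) (closure (gopen hull_group) hull_window).
Proof.
apply hull_compact.
- intros u H U oU Uu. destruct (oU u Uu) as (e & e0 & He).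
  destruct (H e e0) as (v & Cv & uv). apply (Cv U oU). auto.
(* The budget e is split into e/2 for reaching the window, e/4 for reaching a translate at a point
   of L, and e/4 for dropping the almost period. *)
- intros e e0. set (d := Rmin (e / 4) (w x0 / 2)).
  assert (d0 : 0 < d) by (apply Rmin_glb_lt; lra).
  assert (d1 : d <= e / 4) by apply Rmin_l.
  assert (d2 : d <= w x0 / 2) by apply Rmin_r.
  destruct (almost_periods d d0) as (K & cK & HK). destruct (flc K cK) as [l Hl].
  exists (map (gadd x0) l). intros u Cu.
  destruct (Cu (hull_ball u (e / 2))) as (v & (r & lr & uv) & Wv).
  { apply hull_ball_open. }
  { apply hull_ball_center. lra. }
  destruct (hull_window_approx v (e / 4) Wv) as (x & Lx & vx); [lra|].
  destruct (HK (gsub x x0)) as (s & k & Kk & E & Hs).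
  assert (Ek : x = gadd s (gadd x0 k)).
  { replace (gadd s (gadd x0 k)) with (gadd x0 (gadd s k)) by abel. rewrite <- E. abel. }
  exists (gadd x0 k). split.
  + apply in_map, Hl; trivial. exists x, (gadd x0 s). repeat split; trivial.
    * apply almost_period_support with d; trivial. lra.
    * rewrite Ek. abel.
  + apply (uclose_le _ _ (r + (e / 4 + d))); [lra|].
    apply uclose_trans with (hfun v); trivial. apply uclose_trans with (translate x); trivial.
    rewrite Ek. rewrite <- (gadd0 G (gadd x0 k)) at 2. now apply translate_close_shift.
Qed.

Lemma hull_window_interior : has_nonempty_interior hull_group hull_window.
Proof.
exists (fun u : hull => 0 < hfun u gzero). split; [|split].
- intros u p. exists (hfun u gzero / 2). split; [lra|]. intros v H. specialize (H gzero).
  apply Rabs_bounds in H. lra.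
- exists (hull_of x0). simpl. unfold translate. now rewrite gadd0.
- intros u p. now right.
Qed.

Lemma hull_window_periods x :
  period_stable G L -> hull_window (hull_of x) -> L x.
Proof.
intros ps [(y & Ly & E)|p].
- assert (P : forall z, w (gadd z x) = w (gadd z y)).
  { intros z. change (hfun (hull_of x) z = hfun (hull_of y) z). now rewrite E. }
  destruct (ps (fun t => forall z, w (gadd t z) = w z)) as [H _].
  + repeat split.
    * intros z. now rewrite gadd0.
    * intros a b Ha Hb z. rewrite <- gaddA, Ha. auto.
    * intros a Ha z. rewrite <- (Ha (gadd (gopp a) z)). f_equal. abel.
  (* An exact period is an almost period of error 0, so the group of periods lies in L - L. *)
  + intros h Hh. apply almost_period_diffset with 0; trivial. intros z. unfold translate.
    rewrite (gaddC G z h), Hh. replace (gadd z gzero) with z by abel.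
    rewrite Rminus_diag, Rabs_R0. lra.
  + replace x with (gadd (gsub x y) y) by abel. apply H; trivial. intros z.
    replace (gadd (gsub x y) z) with (gadd (gsub z y) x) by abel. rewrite P. f_equal. abel.
- simpl in p. unfold translate in p. rewrite gadd0 in p. now apply support_in.
Qed.

Lemma model_set_of_sup_ap : period_stable G L -> model_set G L.
Proof.
intros ps. exists hull_group, hull_lattice, hull_window.
split; [reflexivity|].
split; [|split; [|split; [|split; [|split; [|split; [|split; [|split]]]]]]].
- intros [x u] [y v] E1 E2. unfold hull_lattice in *. simpl in *. rewrite E1, E2.
  apply hull_of_add.
- intros [x u] E. unfold hull_lattice in *. simpl in *. rewrite E. apply hull_of_opp.
- apply hull_lattice_discrete.
- apply hull_lattice_cocompact.
- intros [x u] [y v] E1 E2 E. unfold hull_lattice in *. simpl in *. congruence.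
- intros V oV [u Vu]. destruct (oV u Vu) as (e & e0 & He).
  destruct (hull_approx u e e0) as [t Ht]. exists (t, hull_of t). split; [reflexivity|].
  now apply He.
- apply hull_window_precompact.
- apply hull_window_interior.
- intros x. split.
  + intros Lx. exists (hull_of x). split; [reflexivity|]. left. now exists x.
  + intros (h & E & Wh). unfold hull_lattice in E. simpl in E. subst h.
    now apply hull_window_periods.
Qed.
End Hull.

(** * Assembly of the equivalences *)

Theorem theorem10p2 (G : LCAGroup) (L : G -> Prop) (K : G -> Prop) :
  sigma_compact G ->
  is_compact (gopen G) K -> has_nonempty_interior G K ->
  relatively_dense G L -> period_stable G L ->
  let i := model_set G L in
  let ii := finite_local_complexity G L /\
            exists w, pos_measure_below_delta G L w /\ nonzero_measure G w /\ sup_ap G w in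
  let iii := finite_local_complexity G L /\
            exists w, pos_measure_below_delta G L w /\ nonzero_measure G w /\ norm_ap G K w in
  let iv := uniformly_discrete G (diffset G L) /\
            exists w, pos_measure_below_delta G L w /\ nonzero_measure G w /\ strongly_ap G w in
  (i <-> ii) /\ (ii <-> iii) /\ (iii <-> iv).
Proof.
intros _ cK (Q & _ & [k Qk] & QK) _ ps i ii iii iv.
assert (i_ii : i -> ii).
{ intros m. split; [now apply model_set_flc|now apply model_set_sup_ap]. }
assert (ii_i : ii -> i).
{ intros (flc & w & (w0 & _ & wL) & [x nz] & sap).
  apply (model_set_of_sup_ap G w L x); trivial. specialize (w0 x). lra. }
assert (ii_iii : ii -> iii).
{ intros (flc & w & Hw & nz & sap). split; trivial. exists w. repeat split; try apply Hw; trivial.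
  apply (norm_ap_of_sup_ap G L); trivial; [now apply flc_uniformly_discrete|apply Hw]. }
assert (iii_ii : iii -> ii).
{ intros (flc & w & Hw & nz & nap). split; trivial. exists w. repeat split; try apply Hw; trivial.
  apply (sup_ap_of_norm_ap G K w k); auto. }
(* Uniform discreteness of L - L asks more than finite local complexity of L; it is obtained by
   passing through the model set. *)
assert (ii_iv : ii -> iv).
{ intros h. split; [now apply model_set_flc, ii_i|].
  destruct h as (flc & w & Hw & nz & sap). exists w. repeat split; try apply Hw; trivial.
  apply (strongly_ap_of_sup_ap G L); trivial. now apply flc_uniformly_discrete. }
assert (iv_ii : iv -> ii).
{ intros (ud & w & Hw & nz & sap). split; [now apply uniformly_discrete_locally_finite|].
  exists w. repeat split; try apply Hw; trivial. now apply (sup_ap_of_strongly_ap G L). }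
tauto.
Qed.
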